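(* Let $\omega>0$, let $p,q,b:\mathbb{R}\to\mathbb{R}$ and $c,e:\mathbb{R}\to(0,+\infty)$ be continuous $\omega$-periodic functions, let $\rho_1,\rho_2>0$ be constants with $\rho_1<\rho_2$, and put $\alpha=\frac{1}{\rho_1+1}$. Assume that the Green's function $G$ of the $\omega$-periodic problem for $u''+p(t)u'+\frac{q(t)}{\alpha}u=h(t)$ satisfies $G(t,s)>0$ for all $(t,s)\in[0,\omega]\times[0,\omega]$, and, with the associated constants $G^*,G_*,\sigma,\delta$ (see context), that $$\frac{(1-\alpha)(G^*+\delta G_* )\delta^2\omega}{\sigma}<1.$$ Furthermore, suppose there exist $R>r>0$ such that $$\frac{1}{\sigma}\left(-\frac{b_*}{e_*}\right)^{\frac{1}{1-\alpha}}\leq r\leq\left(\frac{G_*c_*\omega}{\alpha}\right)^{\frac{1}{\alpha+\alpha\rho_2}}.$$ Then there is at least one positive $\omega$-periodic solution $y$ of $$y''(t)+p(t)y'(t)+\frac{q(t)}{\alpha}y(t)=\frac{c(t)}{\alpha}y^{1-\alpha-\alpha\rho_2}(t)+\frac{e(t)}{\alpha}y^{1-\alpha}(t)+(1-\alpha)\frac{|y'(t)|^2}{y(t)}+\frac{b(t)}{\alpha}$$ satisfying $r\leq\|y\|\leq R$. Consequently, $x=y^\alpha$ is a positive $\omega$-periodic solution of $$x''(t)+p(t)x'(t)+q(t)x(t)=\frac{b(t)}{x^{\rho_1}(t)}+\frac{c(t)}{x^{\rho_2}(t)}+e(t).$$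
   Context: For a continuous $\omega$-periodic function $\phi$, write $\phi^*=\max_{0\le t\le\omega}\phi(t)$, $\phi_*=\min_{0\le t\le\omega}\phi(t)$ and $\|\phi\|_\infty=\max_{t\in[0,\omega]}|\phi(t)|$. For a $C^1$ $\omega$-periodic function, $\|\phi\|=\|\phi\|_\infty+\|\phi'\|_\infty$. Green's function: for the periodic problem $u''(t)+p(t)u'(t)+\frac{q(t)}{\alpha}u(t)=h(t)$, $u(0)=u(\omega)$, $u'(0)=u'(\omega)$, with $h:\mathbb{R}\to(0,+\infty)$ continuous and $\omega$-periodic, the unique $\omega$-periodic solution is $u(t)=\int_0^\omega G(t,s)h(s)\,ds$, where $G(t,s)$ is the Green's function. Constants: $G^*=\max_{0\le s,t\le\omega}G(t,s)$, $G_*=\min_{0\le s,t\le\omega}G(t,s)$, and $$\sigma=\frac{G_*}{G^*+\max_{0\le s,t\le\omega}\left|\frac{\partial G(t,s)}{\partial t}\right|},\qquad \delta=\frac{\max_{0\le s,t\le\omega}\left|\frac{\partial G(t,s)}{\partial t}\right|}{G_*}.$$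
   Formalization: The bound R is not an arbitrary number > r, for which the claim fails (constant coefficients, p=b=0, R close to r); the theorem proved says that for every admissible r there is some R > r and a solution with r ≤ ‖y‖ ≤ R, i.e. the claim holds for all sufficiently large R. *)

(* Defs.v *)
From mathcomp Require Import all_boot all_order all_algebra.
From mathcomp Require Import all_classical all_reals all_analysis.

Set Implicit Arguments.
Unset Strict Implicit.
Unset Printing Implicit Defensive.

Import Order.TTheory GRing.Theory Num.Theory.
Import numFieldNormedType.Exports.

Local Open Scope ring_scope.
Local Open Scope classical_set_scope.

Section PeriodicFunctions.
Context {R : realType}.
Implicit Types (w : R) (phi p k h u : R -> R).

(* Taken over nonempty compact sets, hence attained, when phi is continuous
   (C^1 for [C1norm]). *)
Definition lower w phi : R := inf [set phi t | t in `[0, w]].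
Definition supnorm w phi : R := sup [set `|phi t| | t in `[0, w]].
Definition C1norm w phi : R := supnorm w phi + supnorm w (derive1 phi).

Definition twice_derivable u : Prop :=
  forall t, derivable u t 1 /\ derivable (derive1 u) t 1.

Definition linop p k u (t : R) : R := derive1n 2 u t + p t * derive1 u t + k t * u t.

(* [u] is a w-periodic solution of  u'' + p u' + k u = rhs  on the whole line. *)
Definition periodic_solution w p k (rhs : R -> R) u : Prop :=
  [/\ periodic u w, twice_derivable u & forall t, linop p k u t = rhs t].

End PeriodicFunctions.

Section Green.
Context {R : realType}.
Implicit Types (w : R) (p k : R -> R) (G : R -> R -> R).

Definition square w : set (R * R) := `[0, w] `*` `[0, w].

(* D1 and D2 are dG/dt on the closed triangles t <= s and s <= t; on the
   diagonal they give the two different one-sided derivatives. *)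
Definition green_partials w p k G (D1 D2 : R -> R -> R) : Prop :=
  [/\ {within [set z : R * R | square w z /\ z.1 <= z.2],
         continuous (fun z => D1 z.1 z.2)},
      {within [set z : R * R | square w z /\ z.2 <= z.1],
         continuous (fun z => D2 z.1 z.2)},
      forall t s, 0 < t -> t < s -> s <= w ->
        is_derive t 1 (G ^~ s) (D1 t s) /\
        is_derive t 1 (D1 ^~ s) (- (p t * D1 t s + k t * G t s))
    & forall t s, 0 <= s -> s < t -> t < w ->
        is_derive t 1 (G ^~ s) (D2 t s) /\
        is_derive t 1 (D2 ^~ s) (- (p t * D2 t s + k t * G t s))].

(* G, of which only the values on [0, w] x [0, w] matter, is the Green's
   function of  u'' + p u' + k u = h,  u(0) = u(w),  u'(0) = u'(w). *)
Record is_green w p k G : Prop := IsGreen {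
  green_cont : {within square w, continuous (fun z => G z.1 z.2)};
  green_classical : exists D1 D2,
    [/\ green_partials w p k G D1 D2,
        forall s, 0 < s -> s < w -> D2 s s - D1 s s = 1
      & forall s, 0 < s -> s < w -> G 0 s = G w s /\ D1 0 s = D2 w s];
  green_repr : forall h : R -> R,
    continuous h -> periodic h w -> (forall t, 0 < h t) ->
    forall u : R -> R,
      periodic_solution w p k h u <->
      periodic u w /\
      forall t, 0 <= t <= w ->
        u t = \int[lebesgue_measure]_(s in `[0, w]) (G t s * h s)
}.

Definition Gmax w G : R := sup [set G z.1 z.2 | z in square w].
Definition Gmin w G : R := inf [set G z.1 z.2 | z in square w].

(* dG/dt jumps across t = s, so the maximum of |dG/dt| over the square is the
   supremum over the points where the two-sided derivative exists; it equals
   the maximum of |D1| and |D2| over their closed triangles. *)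
Definition dGmax w G : R :=
  sup [set `|derive1 (G ^~ z.2) z.1| | z in
         [set z : R * R | [/\ 0 < z.1 < w, 0 <= z.2 <= w & z.1 != z.2]]].

Definition sigma w G : R := Gmin w G / (Gmax w G + dGmax w G).
Definition delta w G : R := dGmax w G / Gmin w G.

End Green.

(* Main.v *)
(** Proof idea.  With h = y'' + p y' + (q / alpha) y the problem is the fixed
    point equation h = g(., Th, (Th)'), where T is integration against
    the Green function.  Writing I for the integral of h over a period, one has
    Gmin I <= Th <= Gmax I and |(Th)'| <= dGmax I, so Th lies in the cone
    { sigma ||y|| <= y, |y'| <= delta y }.  Replacing y by max(y, sigma r) in the
    nonlinearity makes it continuous and positive, and the smallness hypothesis
    yields M such that h <= M implies g(., Th, (Th)') <= M.  A fixed point is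
    obtained by restricting h to the span of a partition of unity, applying
    Brouwer's theorem there, and passing to the limit along an ultrafilter, the
    functions Th and (Th)' being equi-Lipschitz.  Finally ||y|| < r would force
    h >= (c_* / alpha) r^(1 - alpha - alpha rho2) and hence y >= r; therefore
    y >= sigma ||y|| >= sigma r and the truncation is inactive. *)

Require Import Defs.
From mathcomp Require Import all_boot all_order all_algebra.
From mathcomp Require Import all_classical all_reals all_analysis.
From mathcomp Require Import ring lra.

Import Order.TTheory GRing.Theory Num.Theory.
Import numFieldNormedType.Exports.

Local Open Scope ring_scope.
Local Open Scope classical_set_scope.

(** * Brouwer's theorem on a cube, up to epsilon *)

(** The unknown is the source [h] rather than [y] because [green_repr] speaks only of positive
    continuous periodic right-hand sides; keeping m <= h <= M with m > 0 stays within its scope. The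
    nonlinearity contains y', while dG/dt jumps on the diagonal. Differentiation under the integral
    is avoided: [green_repr] gives derivability of Th, and a Lipschitz constant of Th then bounds
    (Th)'. The exponent 1 - alpha - alpha rho2 equals alpha (rho1 - rho2) < 0, so the [c] term is
    bounded above where y >= sigma r and bounded below where y is bounded. The only term without
    sublinear growth is (1 - alpha) (y')^2 / y, which in the cone is at most (1 - alpha) delta^2 y;
    this is what the smallness hypothesis has to control. Since the fixed point is a limit anyway,
    Brouwer's theorem is needed only up to epsilon, and a mod 2 labelling argument on a cubical
    lattice supplies that. *)

Section KuhnLemma.
Variables (n p : nat).
Notation pos := {ffun 'I_n -> nat}.
Variable label : 'I_n -> pos -> 'F_2.
Implicit Types (q : pos) (J K : {set 'I_n}) (l : seq 'I_n).

Lemma addF2 (x : 'F_2) : x + x = 0.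
Proof. by apply: (@addrr_pchar2 'F_2); exact: (@pchar_Fp 2). Qed.

Definition translate J q : pos := [ffun i => (q i + (i \in J))%N].

(* Cup product of the mod 2 coboundaries of the labels in [l], evaluated on the
   lattice cube with lowest vertex [q] and edge directions [J].  Only the case
   #|J| = size l matters; the value 1 for empty [l] and arbitrary [J] spares
   all dimension hypotheses. *)
Fixpoint cup l J q : 'F_2 :=
  if l is i :: l' then
    \sum_(j in J) cup l' (J :\ j) q *
      (label i (translate J q) + label i (translate (J :\ j) q))
  else 1.

Lemma translate_setD1 J j q : j \in J -> translate (J :\ j) (translate [set j] q) = translate J q.
Proof.
move=> jJ; apply/ffunP => i; rewrite !ffunE !inE.
by case: (altP (i =P j)) => [->|_] /=; rewrite ?jJ addnAC ?addn0.
Qed.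

Lemma sum_sym_F2 K (S : 'I_n -> 'I_n -> 'F_2) :
  (forall i j, i != j -> S i j = S j i) ->
  \sum_(i in K) \sum_(j in K :\ i) S i j = 0.
Proof.
move=> Ssym.
pose T (i j : 'I_n) := if (i < j)%N then S i j else 0.
have -> : \sum_(i in K) \sum_(j in K :\ i) S i j =
    \sum_(i in K) \sum_(j in K) (T i j + T j i).
  apply: eq_bigr => i iK; rewrite [RHS](big_setD1 i)//= {1 2}/T ltnn addr0 add0r.
  apply: eq_bigr => j; rewrite !inE => /andP[ji jK].
  rewrite /T; case: ltngtP => [||/val_inj ij]; first by rewrite addr0.
    by rewrite add0r Ssym// eq_sym.
  by rewrite ij eqxx in ji.
under eq_bigr do rewrite big_split /=.
by rewrite big_split /= [X in _ + X]exchange_big /= addF2.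
Qed.

(* Graded Leibniz rule: a cup product of coboundaries is a cocycle. *)
Lemma cup_closed l K q :
  \sum_(j in K) (cup l (K :\ j) (translate [set j] q) + cup l (K :\ j) q) = 0.
Proof.
elim: l K => [|k l IH] K /=; first by rewrite big1 // => j _; rewrite addF2.
pose A i j := cup l (K :\ i :\ j) q.
pose d i := label k (translate K q) + label k (translate (K :\ i) q).
have closed_eq i : \sum_(j in K :\ i) cup l (K :\ i :\ j) (translate [set j] q) =
    \sum_(j in K :\ i) A i j.
  apply/eqP; rewrite -subr_eq0; apply/eqP; rewrite -[RHS](IH (K :\ i)) big_split.
  congr (_ + _); rewrite -[LHS]add0r -[X in X - _](addF2 (\sum_(j in K :\ i) A i j)).
  by rewrite addrK.
rewrite big_split /=.
have -> : \sum_(j in K) \sum_(i in K :\ j) cup l (K :\ j :\ i) (translate [set j] q) *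
      (label k (translate (K :\ j) (translate [set j] q)) +
       label k (translate (K :\ j :\ i) (translate [set j] q))) =
    \sum_(i in K) \sum_(j in K :\ i) A i j * d i.
  under [RHS]eq_bigr do rewrite -mulr_suml -closed_eq mulr_suml.
  rewrite (exchange_big_dep (mem K)) /=; last by move=> i j _; rewrite !inE => /andP[].
  apply: eq_bigr => i iK; apply: eq_big => [j|j /andP[jK]].
    by rewrite !inE iK andbT eq_sym andbC.
  rewrite !inE => /andP[ij _]; rewrite translate_setD1 //.
  have DC : K :\ j :\ i = K :\ i :\ j by rewrite !finset.setDDl finset.setUC.
  by rewrite DC translate_setD1 // !inE jK andbT eq_sym.
rewrite -big_split /=.
under eq_bigr do rewrite -big_split /=.
(* The summand is [A i j] times the sum of the labels at the vertices K, K - i, K - i, K - i - j.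
   The two middle ones cancel mod 2, and what remains is symmetric in [i] and [j]. *)
apply: sum_sym_F2 => i j ij.
have DC : K :\ j :\ i = K :\ i :\ j by rewrite !finset.setDDl finset.setUC.
rewrite /A /d DC -!mulrDr; congr (_ * _).
by rewrite -!addrA; congr (_ + _); rewrite !addrA !addF2 !add0r.
Qed.

(** One factor of the product is the coboundary of label [i], which vanishes on every edge of the
    cube. *)
Lemma cup_constant l i J q x : i \in l ->
  (forall K, K \subset J -> label i (translate K q) = x) -> cup l J q = 0.
Proof.
elim: l J => //= k l IH J; rewrite inE => /orP[/eqP<-|il] fx; apply: big1 => j jJ.
  by rewrite !fx ?addF2 ?mulr0 // finset.subsetDl.
rewrite IH ?mul0r// => K KJ; apply: fx.
by rewrite (fintype.subset_trans KJ)// finset.subsetDl.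
Qed.

Definition set_coord q j x : pos := [ffun i => if i == j then x else q i].

(** Coordinates outside [l] keep their value in [q], so a face of the box is the same sum over a
    shorter list with one coordinate frozen. *)
Fixpoint boxsum (l : seq 'I_n) (F : pos -> 'F_2) q : 'F_2 :=
  if l is j :: l' then \sum_(x < p) boxsum l' F (set_coord q j x) else F q.

Lemma boxsum_sum (K : {set 'I_n}) l (F : 'I_n -> pos -> 'F_2) q :
  boxsum l (fun q => \sum_(i in K) F i q) q = \sum_(i in K) boxsum l (F i) q.
Proof.
elim: l q => //= j l IH q; rewrite exchange_big /=.
by apply: eq_bigr => x _; rewrite IH.
Qed.

Lemma eq_boxsum l F F' q : uniq l ->
  (forall q', (forall i, i \notin l -> q' i = q i) ->
     (forall i, i \in l -> (q' i < p)%N) -> F q' = F' q') ->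
  boxsum l F q = boxsum l F' q.
Proof.
elim: l q => [|j l IH] q /= => [_ FF'|/andP[jl ul] FF']; first by apply: FF'.
apply: eq_bigr => x _; apply: IH => // q' q'E q'p; apply: FF' => i.
  rewrite inE negb_or => /andP[ij il].
  by rewrite q'E // ffunE (negPf ij).
rewrite inE => /orP[/eqP->|/q'p //].
by rewrite q'E // ffunE eqxx.
Qed.

Lemma boxsum0 l q : boxsum l (fun=> 0) q = 0.
Proof. by elim: l q => //= j l IH q; apply: big1. Qed.

Lemma boxsum_translate l F j q : j \notin l ->
  boxsum l (fun q => F (translate [set j] q)) q = boxsum l F (translate [set j] q).
Proof.
elim: l q => //= i l IH q; rewrite inE negb_or => /andP[ji jl].
apply: eq_bigr => x _; rewrite IH //; congr boxsum.
apply/ffunP => k; rewrite !ffunE !inE.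
by case: (eqVneq k i) => [->|//]; rewrite eq_sym (negPf ji) addn0.
Qed.

Lemma boxsumD l F F' q :
  boxsum l (fun q => F q + F' q) q = boxsum l F q + boxsum l F' q.
Proof.
elim: l q => //= j l IH q; rewrite -big_split.
by apply: eq_bigr => x _; rewrite IH.
Qed.

(** Telescoping in direction [j]; in ['F_2] the two ends need no signs. *)
Lemma boxsum_head j l F q : j \notin l ->
  boxsum (j :: l) (fun q => F (translate [set j] q) + F q) q =
  boxsum l F (set_coord q j p) + boxsum l F (set_coord q j 0).
Proof.
move=> jl /=; pose g x := boxsum l F (set_coord q j x).
rewrite (eq_bigr (fun x : 'I_p => g x.+1 + g x)) => [|x _].
  elim: p => [|m IHm]; first by rewrite big_ord0 addF2.
  rewrite big_ord_recr /= IHm addrACA [X in X + _]addrC -addrA.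
  by congr (_ + _); rewrite addrC -addrA addF2 addr0.
rewrite boxsumD boxsum_translate //; congr (boxsum _ _ _ + _).
apply/ffunP => k; rewrite !ffunE !inE.
by case: (k == j); rewrite ?addn1 ?addn0.
Qed.

Lemma boxsum_coboundary l F j q : uniq l -> j \in l ->
  (forall q, q j = 0 \/ q j = p -> F q = 0) ->
  boxsum l (fun q => F (translate [set j] q) + F q) q = 0.
Proof.
elim: l q => // i l IH q /andP[il ul]; rewrite inE => ijl F0.
have [ji|ji] := eqVneq j i.
  move: il; rewrite -ji => jl; rewrite boxsum_head //.
  have bs0 x : x = 0 \/ x = p -> boxsum l F (set_coord q j x) = 0.
    move=> x0p; rewrite -(boxsum0 l (set_coord q j x)); apply: eq_boxsum => // q' q'E _.
    by apply: F0; rewrite q'E // ffunE eqxx.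
  by rewrite !bs0 ?addr0; [|left|right].
rewrite (negPf ji) /= in ijl.
by rewrite /= big1 // => x _; apply: IH.
Qed.

Hypothesis lab0 : forall i q, q i = 0 -> label i q = 0.
Hypothesis lab1 : forall i q, q i = p -> label i q = 1.

(* The cup product is a coboundary, so its sum telescopes to the faces of the
   box.  On the faces of direction [i] the label [i] is constant, which leaves
   only the upper face in the direction of the last label. *)
Lemma boxsum_cup l q : uniq l -> (forall i, i \notin l -> q i = p) ->
  boxsum l (cup l [set i in l]) q = 1.
Proof.
elim: l q => //= j l IH q /andP[jl ul] qp.
set J := [set i in _].
have Jj : J :\ j = [set i in l].
  by apply/setP => i; rewrite !inE; case: eqVneq => //= ->; rewrite (negPf jl).
pose c i := cup l (J :\ i).
pose beta i q := c i q * label j (translate (J :\ i) q).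
rewrite -[LHS]/(boxsum (j :: l) (cup (j :: l) J) q).
rewrite (eq_boxsum _ _ (fun q =>
  \sum_(i in J) (beta i (translate [set i] q) + beta i q))) /=; last 2 first.
- by rewrite jl.
- move=> q' _ _.
  (* The cocycle relation [cup_closed], multiplied by label [j] at the far vertex, is added: for a
     cocycle c, c cup d(label) is the coboundary of c cup label, whose value on the face omitting
     [i] is [beta i]. *)
  have := congr1 ( *%R^~ (label j (translate J q'))) (cup_closed l J q').
  rewrite mul0r mulr_suml => E; rewrite /= -[LHS]addr0 -[X in _ + X]E -big_split /=.
  apply: eq_bigr => i iJ; rewrite /beta /c translate_setD1 // mulrDr mulrDl.
  by rewrite [X in X + _]addrC addrACA addF2 addr0 addrC.
rewrite -[LHS]/(boxsum (j :: l) _ q) boxsum_sum.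
rewrite (big_setD1 j) ?inE ?eqxx //.
set B := boxsum (j :: l); rewrite /= {}/B.
rewrite [X in _ + X]big1 => [|i]; last first.
  rewrite Jj !inE => il; apply: boxsum_coboundary => //=; rewrite ?inE ?il ?orbT ?jl//.
  move=> q' q'i; rewrite /beta /c.
  have shi K : K \subset J :\ i -> translate K q' i = q' i.
    move=> /fintype.subsetP KJ; rewrite !ffunE.
    case: (boolP (i \in K)) => [/KJ|]; last by rewrite addn0.
    by rewrite !inE eqxx.
  case: q'i => q'i.
    by rewrite (@cup_constant _ i _ _ 0) ?mul0r // => K /shi E; apply: lab0; rewrite E.
  by rewrite (@cup_constant _ i _ _ 1) ?mul0r // => K /shi E; apply: lab1; rewrite E.
rewrite addr0 boxsum_head // /beta /c Jj.
have shj q' : translate [set i in l] q' j = q' j by rewrite ffunE inE (negPf jl) addn0.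
rewrite [X in _ + X](eq_boxsum _ _ (fun=> 0)) => //; last first.
  move=> q' q'E _; rewrite lab0 ?mulr0// shj.
  by rewrite q'E // ffunE eqxx.
rewrite boxsum0 addr0 (eq_boxsum _ _ (cup l [set i in l])) => //.
  apply: IH => // i il; rewrite ffunE; case: eqVneq => // ij.
  by apply: qp; rewrite inE negb_or ij.
move=> q' q'E _; rewrite lab1 ?mulr1// shj.
by rewrite q'E // ffunE eqxx.
Qed.

(* The cup product of all labels sums to 1 over the box, so it is nonzero on some
   cube, and there no label can be constant. *)
Lemma kuhn_lemma : exists2 q : pos, forall i, (q i < p)%N &
  forall i x, exists K, label i (translate K q) != x.
Proof.
have [//|] := pselect (exists2 q : pos, forall i, (q i < p)%N &
  forall i x, exists K, label i (translate K q) != x).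
move=> nq.
have := @boxsum_cup (enum 'I_n) [ffun=> p] (enum_uniq _).
rewrite (eq_boxsum _ _ (fun=> 0)) ?enum_uniq // => [|q _ qp].
  rewrite boxsum0 => H; have : (0 : 'F_2) = 1 by apply: H => i; rewrite mem_enum.
  by move=> /esym/eqP; rewrite oner_eq0.
apply/eqP/negPn/negP => /eqP cup0; apply: nq.
exists q => [i|i x]; first by apply: qp; rewrite mem_enum.
have [//|nK] := pselect (exists K, label i (translate K q) != x).
case: cup0; apply: (@cup_constant _ i _ _ x) => [|K _].
  by rewrite mem_enum.
by apply/eqP/negPn/negP => H; apply: nK; exists K.
Qed.

End KuhnLemma.

(** Label [i] records whether [Phi] lowers coordinate [i], except on the faces, where it is set as
    [kuhn_lemma] demands; invariance of the box makes that exception harmless. In a cell where no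
    label is constant, each displacement Phi_i - a_i takes both weak signs, hence is small. *)
Lemma brouwer_approx {R : realType} (n : nat) (lo hi : R)
    (Phi : ('I_n -> R) -> 'I_n -> R) :
  let box a := forall i, lo <= a i <= hi in
  lo <= hi ->
  (forall a, box a -> box (Phi a)) ->
  (forall eps : R, 0 < eps -> exists2 eta : R, 0 < eta & forall a b, box a -> box b ->
     (forall i, `|a i - b i| <= eta) -> forall i, `|Phi a i - Phi b i| <= eps) ->
  forall eps : R, 0 < eps ->
  exists2 a, box a & forall i, `|Phi a i - a i| <= eps.
Proof.
move=> box lohi Phibox Phiuc eps eps0.
have [eta eta0 Phieta] := Phiuc (eps / 2) ltac:(by rewrite divr_gt0).
pose step p : R := (hi - lo) / p.+1%:R.
(* The mesh serves twice: below [eta] it makes [Phi] vary by at most eps / 2 on a cell, and below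
   eps / 2 it bounds the variation of the vertices themselves. *)
have [p stepp] : exists p, step p <= Num.min eta (eps / 2).
  pose d := Num.min eta (eps / 2).
  have d0 : 0 < d by rewrite lt_min eta0 divr_gt0.
  exists (Num.Def.trunc ((hi - lo) / d)).
  have := Num.Theory.truncnS_gt ((hi - lo) / d).
  by rewrite ltr_pdivrMr// => /ltW; rewrite /step ler_pdivrMr ?ltr0n // mulrC.
(* The truncation at [p.+1] sends every lattice point into the box, so that [label] is meaningful
   without side conditions. *)
pose pt (q : {ffun 'I_n -> nat}) (i : 'I_n) := lo + step p * (minn (q i) p.+1)%:R.
have ptbox q : box (pt q).
  move=> i; rewrite /pt lerDl mulr_ge0 ?divr_ge0 ?subr_ge0 //=.
  rewrite -lerBrDl /step -mulrA ler_piMr ?subr_ge0 //.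
  by rewrite mulrC ler_pdivrMr ?ltr0n // mul1r ler_nat geq_minr.
pose label (i : 'I_n) (q : {ffun 'I_n -> nat}) : 'F_2 :=
  if q i == 0%N then 0 else if (q i == p.+1) || (Phi (pt q) i < pt q i) then 1 else 0.
have [//|//|q qp qlab] := @kuhn_lemma n p.+1 label.
- by move=> i q qi; rewrite /label qi.
- by move=> i q qi; rewrite /label qi eqxx.
have ptK K K' i : `|pt (translate _ K q) i - pt (translate _ K' q) i| <= step p.
  rewrite /pt !ffunE opprD addrACA subrr add0r -mulrBr normrM ger0_norm; last first.
    by rewrite divr_ge0 ?subr_ge0.
  rewrite ler_piMr ?divr_ge0 ?subr_ge0 //.
  have minE (A : {set 'I_n}) : minn (q i + (i \in A)) p.+1 = (q i + (i \in A))%N.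
    by apply/minn_idPl; case: (i \in A); rewrite ?addn1 ?addn0 // ltnW.
  by rewrite !minE !natrD opprD addrACA subrr add0r; do 2!case: (i \in _);
    rewrite ?subrr ?subr0 ?sub0r ?normrN ?normr0 ?normr1.
move: stepp; rewrite le_min => /andP[stepeta stepeps].
exists (pt (translate _ finset.set0 q)) => // i.
have [K0 lab0] := qlab i 1.
have [K1 lab1] := qlab i 0.
have up : Phi (pt (translate _ K0 q)) i >= pt (translate _ K0 q) i.
  move: lab0; rewrite /label; case: (translate _ K0 q i =P 0%N) => [q0 _|_]; last first.
    case: (boolP (_ || _)) => [_|]; first by move/eqP.
    by rewrite negb_or -leNgt => /andP[].
  have -> : pt (translate _ K0 q) i = lo by rewrite /pt q0 min0n mulr0 addr0.
  by have /andP[] := Phibox _ (ptbox (translate _ K0 q)) i.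
have dn : Phi (pt (translate _ K1 q)) i <= pt (translate _ K1 q) i.
  move: lab1; rewrite /label; case: (translate _ K1 q i =P 0%N) => [_ /eqP //|_].
  case: (boolP (_ || _)) => [/orP[/eqP qe|/ltW//] _|_ /eqP //].
  have -> : pt (translate _ K1 q) i = hi.
    by rewrite /pt qe minnn /step -mulrA mulVf ?pnatr_eq0 // mulr1 addrC subrK.
  by have /andP[] := Phibox _ (ptbox (translate _ K1 q)) i.
have close K := Phieta _ _ (ptbox (translate _ finset.set0 q)) (ptbox (translate _ K q))
  (fun i => le_trans (ptK _ _ i) stepeta) i.
have := close K0; have := close K1.
have := ptK finset.set0 K0 i; have := ptK finset.set0 K1 i.
rewrite !ler_norml => *; lra.
Qed.

(** * The Green function *)

Lemma within_comp {T U V : topologicalType} (A : set T) (B : set U)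
    (f : T -> U) (g : U -> V) :
  {within A, continuous f} -> {within B, continuous g} ->
  (forall x, A x -> B (f x)) -> {within A, continuous (g \o f)}.
Proof.
move=> /subspace_continuousP cf /subspace_continuousP cg AB.
apply/subspace_continuousP => x Ax W /= Wgf.
have := cf x Ax _ (cg _ (AB _ Ax) _ Wgf).
rewrite /fmap /within /= !nbhs_simpl /=; apply: filterS => y h Ay.
by apply: h => //; exact: AB.
Qed.

Lemma continuous_pair {T U V : topologicalType} (f : T -> U) (g : T -> V) :
  continuous f -> continuous g -> continuous (fun x => (f x, g x)).
Proof.
move=> cf cg x; apply: (@cvg_pair _ _ _ (nbhs x) (nbhs (f x)) (nbhs (g x))).
  exact: cf.
exact: cg.
Qed.

Lemma within_cst {T U : topologicalType} (A : set T) (x : U) :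
  {within A, continuous (fun=> x)}.
Proof. by apply: continuous_subspaceT => y; exact: cvg_cst. Qed.

Section GreenBounds.
Context {R : realType} {w : R} {p k : R -> R} {G : R -> R -> R}.
Hypothesis w_gt0 : 0 < w.
Hypothesis Ggreen : is_green w p k G.
Hypothesis G_gt0 : forall t s, 0 <= t <= w -> 0 <= s <= w -> 0 < G t s.

Lemma squareE (z : R * R) : square w z <-> 0 <= z.1 <= w /\ 0 <= z.2 <= w.
Proof. by rewrite /square /= !in_itv. Qed.

Lemma compact_square : compact (square w).
Proof. by apply: compact_setX; exact: segment_compact. Qed.

Lemma square_neq0 : square w !=set0.
Proof. by exists (0, 0); apply/squareE; rewrite /= lexx ltW. Qed.

Lemma Gmax_ge t s : 0 <= t <= w -> 0 <= s <= w -> G t s <= Gmax w G.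
Proof.
move=> tw sw; have [z _ zmax] :=
  compact_EVT_max square_neq0 compact_square (green_cont Ggreen).
apply: ub_le_sup; last by exists (t, s) => //; apply/squareE.
by exists (G z.1 z.2) => _ [z' z'w <-]; apply: zmax; rewrite inE.
Qed.

Lemma Gmin_le t s : 0 <= t <= w -> 0 <= s <= w -> Gmin w G <= G t s.
Proof.
move=> tw sw; have [z _ zmin] :=
  compact_EVT_min square_neq0 compact_square (green_cont Ggreen).
apply: ge_inf; last by exists (t, s) => //; apply/squareE.
by exists (G z.1 z.2) => _ [z' z'w <-]; apply: zmin; rewrite inE.
Qed.

Lemma Gmin_gt0 : 0 < Gmin w G.
Proof.
have [z zw zmin] := compact_EVT_min square_neq0 compact_square (green_cont Ggreen).
have /squareE[z1 z2] : square w z by rewrite inE in zw.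
apply: (lt_le_trans (G_gt0 _ _ z1 z2)); apply: lb_le_inf.
  by have [z' z'w] := square_neq0; exists (G z'.1 z'.2), z'.
by move=> _ [z' z'w <-]; apply: zmin; rewrite inE.
Qed.

Lemma Green_cont_s t : 0 <= t <= w -> {within `[0, w], continuous (G t)}.
Proof.
move=> tw; apply: (within_comp _ (square w) (fun s => (t, s)) (fun z => G z.1 z.2)); last 2 first.
- exact: (green_cont Ggreen).
- by move=> x xw; apply/squareE; move: xw; rewrite /= in_itv.
apply: continuous_subspaceT; apply: continuous_pair => s; [exact: cvg_cst|exact: cvg_id].
Qed.

Lemma Green_cont_t s : 0 <= s <= w -> {within `[0, w], continuous (G ^~ s)}.
Proof.
move=> sw; apply: (within_comp _ (square w) (fun t => (t, s)) (fun z => G z.1 z.2)); last 2 first.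
- exact: (green_cont Ggreen).
- by move=> x xw; apply/squareE; move: xw; rewrite /= in_itv.
apply: continuous_subspaceT; apply: continuous_pair => t; [exact: cvg_id|exact: cvg_cst].
Qed.

(** The supremum is over a bounded set because [D1] and [D2] are continuous on the closed triangles,
    which are compact. *)
Lemma dGmax_ge t s : 0 < t < w -> 0 <= s <= w -> t != s ->
  derivable (G ^~ s) t 1 /\ `|derive1 (G ^~ s) t| <= dGmax w G.
Proof.
have [D1 [D2 [[cD1 cD2 dD1 dD2] _ _]]] := green_classical Ggreen.
have bnd (f : R -> R -> R) (A : set (R * R)) : closed A ->
    {within [set z | square w z /\ A z], continuous (fun z => f z.1 z.2)} ->
    exists M, forall t s, A (t, s) -> 0 <= t <= w -> 0 <= s <= w -> `|f t s| <= M.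
  move=> Acl /continuous_compact cf.
  have /cf/compact_bounded[M [_ MA]] : compact (square w `&` A).
    by apply: compact_closedI => //; exact: compact_square.
  exists (M + 1) => a c acA a0 c0; apply: (MA (M + 1)); first by rewrite ltrDl.
  by exists (a, c) => //; split => //; exact/squareE.
have closed_cmp (f : R * R -> R) : continuous f -> closed [set z | 0 <= f z].
  by move=> cf; apply: (@preimage_closed _ _ f [set x | 0 <= x]) => //; exact: closed_ge.
have [M1 M1P] : exists M, forall t s, t <= s -> 0 <= t <= w -> 0 <= s <= w -> `|D1 t s| <= M.
  apply: (bnd D1 [set z | z.1 <= z.2]) => //.
  have -> : [set z : R * R | z.1 <= z.2] = [set z | 0 <= z.2 - z.1].
    by apply/seteqP; split => z /=; rewrite subr_ge0.
  by apply: closed_cmp => z; apply: continuousB; [exact: cvg_snd|exact: cvg_fst].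
have [M2 M2P] : exists M, forall t s, s <= t -> 0 <= t <= w -> 0 <= s <= w -> `|D2 t s| <= M.
  apply: (bnd D2 [set z | z.2 <= z.1]) => //.
  have -> : [set z : R * R | z.2 <= z.1] = [set z | 0 <= z.1 - z.2].
    by apply/seteqP; split => z /=; rewrite subr_ge0.
  by apply: closed_cmp => z; apply: continuousB; [exact: cvg_fst|exact: cvg_snd].
have dG a c : 0 < a < w -> 0 <= c <= w -> a != c ->
    derivable (G ^~ c) a 1 /\ `|derive1 (G ^~ c) a| <= Num.max M1 M2.
  move=> /andP[a0 aw] /andP[c0 cw] ac.
  have [{}ac|ca|E] := ltgtP a c; last by rewrite E eqxx in ac.
    have [[da Da] _] := dD1 a c a0 ac cw; split; first exact: da.
    by rewrite derive1E Da le_max M1P //; [rewrite ltW|rewrite !ltW|rewrite c0].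
  have [[da Da] _] := dD2 a c c0 ca aw; split; first exact: da.
  by rewrite derive1E Da le_max M2P ?orbT //; [rewrite ltW|rewrite !ltW|rewrite c0].
move=> tw sw ts; have [dGt _] := dG _ _ tw sw ts; split => //.
apply: ub_le_sup; last by exists (t, s).
by exists (Num.max M1 M2) => _ [[a c] /= [aw cw ac] <-]; have [] := dG _ _ aw cw ac.
Qed.

Lemma Green_lipschitz t1 t2 s : 0 <= t1 <= w -> 0 <= t2 <= w -> 0 <= s <= w ->
  `|G t1 s - G t2 s| <= dGmax w G * `|t1 - t2|.
Proof.
move=> t1w t2w sw.
wlog t12 : t1 t2 t1w t2w / t1 < t2 => [H|].
  have [/H|/H|->] := ltgtP t1 t2; [exact| |by rewrite !subrr normr0 mulr0].
  by rewrite distrC (distrC t2); exact.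
have mvt (a b : R) : 0 <= a -> a <= b -> b <= w -> (forall t, a < t < b -> t != s) ->
    `|G b s - G a s| <= dGmax w G * (b - a).
  move=> a0; rewrite le_eqVlt => /predU1P[-> _ _|ab bw abs].
    by rewrite !subrr normr0 mulr0.
  have dG t : a < t < b -> derivable (G ^~ s) t 1 /\ `|derive1 (G ^~ s) t| <= dGmax w G.
    move=> atb; apply: dGmax_ge => //; last exact: abs.
    by move: atb => /andP[at_ tb]; rewrite (le_lt_trans a0)//= (lt_le_trans tb).
  have [] := @MVT R (G ^~ s) (derive1 (G ^~ s)) a b ab.
  - move=> t; rewrite in_itv => /dG[dGt _].
    by rewrite derive1E; exact/derivableP.
  - apply: continuous_subspaceW (Green_cont_t _ sw).
    by apply: subset_itv; rewrite bnd_simp.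
  move=> t; rewrite in_itv => /dG[_ dGt] ->.
  have ba0 : 0 <= b - a by rewrite subr_ge0 ltW.
  by rewrite normrM (ger0_norm ba0) ler_wpM2r.
have t21 : 0 <= t2 - t1 by rewrite subr_ge0 ltW.
rewrite distrC (distrC t1) (ger0_norm t21).
move: t1w t2w => /andP[t10 t1w] /andP[t20 t2w].
have [st1|t1s] := leP s t1.
  by apply: mvt => // [|t /andP[t1t _]]; rewrite ?ltW// gt_eqF// (le_lt_trans st1).
have [st2|t2s] := ltP s t2; last first.
  by apply: mvt => // [|t /andP[_ tt2]]; rewrite ?ltW// lt_eqF// (lt_le_trans tt2).
have -> : G t2 s - G t1 s = (G t2 s - G s s) + (G s s - G t1 s) by rewrite addrA subrK.
apply: (le_trans (ler_normD _ _)).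
have -> : t2 - t1 = (t2 - s) + (s - t1) by rewrite addrA subrK.
move: sw => /andP[s0 sw].
rewrite mulrDr lerD//; apply: mvt => //; rewrite ?ltW// => t /andP[a b].
  by rewrite gt_eqF.
by rewrite lt_eqF.
Qed.

End GreenBounds.

(** * Periodic functions and integrals over one period *)

Section Periodic.
Context {R : realType} {w : R}.
Implicit Types f : R -> R.
Hypothesis w_gt0 : 0 < w.

Definition rem_period (t : R) : R := t - w *~ Num.floor (t / w).

Lemma rem_period_bounds t : 0 <= rem_period t < w.
Proof.
have /andP[tl tr] := floor_itv (t / w).
rewrite /rem_period subr_ge0 -mulrzl -ler_pdivlMr// tl /=.
have : t < (Num.floor (t / w) + 1)%:~R * w by rewrite -ltr_pdivrMr.
by rewrite intrD mulrDl mul1r mulrzl ltrBlDl.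
Qed.

Lemma rem_period_id t : 0 <= t < w -> rem_period t = t.
Proof.
move=> /andP[t0 tw]; rewrite /rem_period (@floor_def _ _ 0) ?mulr0z ?subr0//.
by rewrite add0r mulr1z ltr_pdivrMr// mul1r tw divr_ge0// ltW.
Qed.

Lemma periodicz f : periodic f w -> forall m t, f (t + w *~ m) = f t.
Proof.
move=> fw [n|n] t; first by rewrite -pmulrn periodicn.
by rewrite NegzE mulrNz -pmulrn -[LHS](periodicn fw n.+1) subrK.
Qed.

Lemma rem_period_periodic : periodic rem_period w.
Proof.
move=> t; rewrite /rem_period mulrDl mulfV ?gt_eqF//.
by rewrite floorDrz ?rpred1 // floor1 mulrzDr mulr1z opprD addrACA subrr addr0.
Qed.

Lemma periodic_rem f : periodic f w -> forall t, f t = f (rem_period t).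
Proof. by move=> fw t; rewrite /rem_period -mulrNz periodicz. Qed.

Lemma periodic_derive1 f : periodic f w -> periodic (derive1 f) w.
Proof.
by move=> fw t; rewrite /derive1; under eq_fun do rewrite addrA !fw.
Qed.

Lemma derive1_lipschitz_le f t L : derivable f t 1 ->
  (\forall h \near 0^'+, `|f (h + t) - f t| <= L * h) -> `|derive1 f t| <= L.
Proof.
move=> dft fL.
have cvf : (fun h => h^-1 *: (f (h + t) - f t)) @ 0^'+ --> derive1 f t.
  apply: cvg_dnbhs_at_right; rewrite /derive1.
  move: dft; rewrite /derivable.
  by under eq_fun do rewrite /= scaler1.
apply: (cvgr_to_le (cvg_norm cvf)).
move: fL; apply: filterS2 (nbhs_right_gt 0) => h h0 fh.
by rewrite normrZ normfV (gtr0_norm h0) ler_pdivrMl// mulrC.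
Qed.

(** From a point of [[0, w[] small increments to the right stay inside the period, and for a
    derivable function they determine the derivative. *)
Lemma periodic_derive1_le f L : periodic f w -> (forall t, derivable f t 1) ->
  (forall t s, 0 <= t <= w -> 0 <= s <= w -> `|f t - f s| <= L * `|t - s|) ->
  forall t, `|derive1 f t| <= L.
Proof.
move=> fw df fL t; rewrite (periodic_rem _ (periodic_derive1 _ fw)).
have /andP[t0 tw] := rem_period_bounds t.
apply: derive1_lipschitz_le => //; near=> h.
have h0 : 0 < h by near: h; exact: nbhs_right_gt.
have hw : h < w - rem_period t by near: h; apply: nbhs_right_lt; rewrite subr_gt0.
have := fL (h + rem_period t) (rem_period t); rewrite addrK (gtr0_norm h0); apply.
  by rewrite addr_ge0 ?(ltW h0)//= ltW// -ltrBrDr.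
by rewrite t0 ltW.
Unshelve. all: by end_near. Qed.

Lemma lipschitz_derive1 f L : (forall t, derivable f t 1) ->
  (forall t, `|derive1 f t| <= L) -> forall t s, `|f t - f s| <= L * `|t - s|.
Proof.
move=> df fL t s.
wlog ts : t s / s < t => [H|].
  have [/H|/H|->] := ltgtP s t; [exact| |by rewrite !subrr normr0 mulr0].
  by rewrite distrC (distrC t); exact.
have [| |c _ ->] := @MVT R f (derive1 f) s t ts.
- by move=> x _; rewrite derive1E; exact/derivableP.
- apply: continuous_subspaceT => x.
  by apply/differentiable_continuous/derivable1_diffP.
by rewrite normrM ler_wpM2r.
Qed.

End Periodic.

Section SegmentIntegral.
Context {R : realType} {w : R}.
Hypothesis w_gt0 : 0 < w.
Implicit Types f g : R -> R.
Notation mu := (@lebesgue_measure R).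
Notation seg := (`[0, w]%classic : set R).

Lemma seg_integrable f : {within seg, continuous f} -> mu.-integrable seg (EFin \o f).
Proof. by move=> cf; apply: continuous_compact_integrable => //; exact: segment_compact. Qed.

Lemma seg_int_cst (c : R) : \int[mu]_(s in seg) c = c * w.
Proof.
rewrite Rintegral_cst //= lebesgue_measure_itv /= lte_fin w_gt0.
by rewrite oppr0 adde0.
Qed.

Lemma seg_int_le f g : {within seg, continuous f} -> {within seg, continuous g} ->
  (forall s, 0 <= s <= w -> f s <= g s) ->
  \int[mu]_(s in seg) f s <= \int[mu]_(s in seg) g s.
Proof.
move=> cf cg fg; apply: le_Rintegral; rewrite ?seg_integrable //=.
Qed.

Lemma seg_int_norm_le f g : {within seg, continuous f} -> {within seg, continuous g} ->
  (forall s, 0 <= s <= w -> `|f s| <= g s) ->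
  `|\int[mu]_(s in seg) f s| <= \int[mu]_(s in seg) g s.
Proof.
move=> cf cg fg; apply: (le_trans (le_normr_Rintegral _ _)) => //.
  exact: seg_integrable.
apply: seg_int_le => // x; apply: cvg_norm; exact: cf.
Qed.

End SegmentIntegral.

(** * The solution operator *)

Lemma within_continuousM {R : realType} {T : topologicalType} (A : set T) (f g : T -> R) :
  {within A, continuous f} -> {within A, continuous g} ->
  {within A, continuous (fun x => f x * g x)}.
Proof. by move=> cf cg x; apply: cvgM; [exact: cf|exact: cg]. Qed.

Section GreenOp.
Context {R : realType} {w : R} {p k : R -> R} {G : R -> R -> R}.
Hypothesis w_gt0 : 0 < w.
Hypothesis Ggreen : is_green w p k G.
Hypothesis G_gt0 : forall t s, 0 <= t <= w -> 0 <= s <= w -> 0 < G t s.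
Implicit Types f g h : R -> R.
Notation mu := (@lebesgue_measure R).
Notation seg := (`[0, w]%classic : set R).

(** [G] is constrained only on the square, hence the reduction of [t] modulo the period. *)
Definition green_op f (t : R) : R := \int[mu]_(s in seg) (G (rem_period (w := w) t) s * f s).

Let rem_period_seg t : 0 <= rem_period (w := w) t <= w.
Proof. by have /andP[-> /ltW] := rem_period_bounds w_gt0 t. Qed.

Lemma green_op_integrand_cont f t : continuous f -> 0 <= t <= w ->
  {within seg, continuous (fun s => G t s * f s)}.
Proof.
move=> cf tw; apply: within_continuousM; last exact: continuous_subspaceT.
exact: (Green_cont_s Ggreen).
Qed.

(** At t = w the reduced argument is 0, so G 0 s = G w s is required. It is known for 0 < s < w, and
    the two endpoints do not affect the integral. *)
Lemma green_op_seg f t : continuous f -> 0 <= t <= w ->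
  green_op f t = \int[mu]_(s in seg) (G t s * f s).
Proof.
move=> cf /andP[t0]; rewrite le_eqVlt => /predU1P[->{t t0}|tw]; last first.
  by rewrite /green_op rem_period_id // t0.
have -> : green_op f w = green_op f 0.
  by rewrite /green_op -[w in rem_period w]add0r rem_period_periodic.
rewrite /green_op rem_period_id ?lexx//.
have [D1 [D2 [_ _ Gper]]] := green_classical Ggreen.
have i0 t : 0 <= t <= w -> mu.-integrable seg (EFin \o (fun s => G t s * f s)).
  by move=> tw; apply: seg_integrable; exact: green_op_integrand_cont.
have ioo t : 0 <= t <= w -> \int[mu]_(s in seg) (G t s * f s) =
    \int[mu]_(s in `]0, w[) (G t s * f s).
  move=> tw; rewrite Rintegral_itv_bndo_bndc; last first.
    by apply: integrableS (i0 t tw) => //; apply: subset_itv; rewrite bnd_simp.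
  rewrite Rintegral_itv_obnd_cbnd //.
  by apply: integrableS (i0 t tw) => //; apply: subset_itv; rewrite bnd_simp.
rewrite !ioo ?lexx ?ltW//; apply: eq_Rintegral => s.
by rewrite inE /= in_itv => /= /andP[s0 sw]; have [->] := Gper s s0 sw.
Qed.

Lemma green_op_periodic f : periodic (green_op f) w.
Proof. by move=> t; rewrite /green_op rem_period_periodic. Qed.

Lemma green_op_solution h : continuous h -> periodic h w -> (forall t, 0 < h t) ->
  periodic_solution w p k h (green_op h).
Proof.
move=> ch ph h0; apply/(green_repr Ggreen) => //; split; first exact: green_op_periodic.
by move=> t; exact: green_op_seg.
Qed.

Lemma gopB f g t : continuous f -> continuous g ->
  green_op (fun s => f s - g s) t = green_op f t - green_op g t.
Proof.
move=> cf cg; rewrite /green_op -RintegralB //=; last 2 first.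
- by apply: seg_integrable; exact: green_op_integrand_cont.
- by apply: seg_integrable; exact: green_op_integrand_cont.
by apply: eq_Rintegral => s _; rewrite mulrBr.
Qed.

Let seg_intZ c f : continuous f ->
  \int[mu]_(s in seg) (c * f s) = c * \int[mu]_(s in seg) f s.
Proof.
move=> cf; apply: RintegralZl => //; apply: seg_integrable.
exact: continuous_subspaceT.
Qed.

Let seg_contZ c f : continuous f -> {within seg, continuous (fun s => c * f s)}.
Proof.
move=> cf; apply: within_continuousM; first exact: within_cst.
exact: continuous_subspaceT.
Qed.

Lemma green_op_ge h t : continuous h -> (forall s, 0 < h s) ->
  Gmin w G * \int[mu]_(s in seg) h s <= green_op h t.
Proof.
move=> ch h0; rewrite -seg_intZ //; apply: seg_int_le => [||s sw].
- exact: seg_contZ.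
- exact: green_op_integrand_cont.
- by rewrite ler_wpM2r ?(ltW (h0 s))//; exact: (Gmin_le w_gt0 Ggreen).
Qed.

Lemma green_op_le h t : continuous h -> (forall s, 0 < h s) ->
  green_op h t <= Gmax w G * \int[mu]_(s in seg) h s.
Proof.
move=> ch h0; rewrite -seg_intZ //; apply: seg_int_le => [||s sw].
- exact: green_op_integrand_cont.
- exact: seg_contZ.
- by rewrite ler_wpM2r ?(ltW (h0 s))//; exact: (Gmax_ge w_gt0 Ggreen).
Qed.

Lemma green_op_norm_le f M t : continuous f -> (forall s, 0 <= s <= w -> `|f s| <= M) ->
  `|green_op f t| <= Gmax w G * (M * w).
Proof.
move=> cf fM; rewrite mulrA -seg_int_cst //; apply: seg_int_norm_le => [||s sw].
- exact: green_op_integrand_cont.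
- exact: within_cst.
- have Gts := G_gt0 _ _ (rem_period_seg t) sw.
  rewrite normrM (gtr0_norm Gts); apply: ler_pM => //; last exact: fM.
    exact: ltW.
  exact: (Gmax_ge w_gt0 Ggreen).
Qed.

(** The bound [M] is a function so that it can be [f] itself when [f] is positive, and a constant
    for a difference of sources. *)
Lemma green_op_lipschitz f M t1 t2 : continuous f ->
  (forall s, 0 <= s <= w -> `|f s| <= M s) -> {within seg, continuous M} ->
  0 <= t1 <= w -> 0 <= t2 <= w ->
  `|green_op f t1 - green_op f t2| <= dGmax w G * (\int[mu]_(s in seg) M s) * `|t1 - t2|.
Proof.
move=> cf fM cM t1w t2w; rewrite !green_op_seg // -RintegralB //=; last 2 first.
- by apply: seg_integrable; exact: green_op_integrand_cont.
- by apply: seg_integrable; exact: green_op_integrand_cont.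
rewrite mulrAC -RintegralZl //; last exact: seg_integrable.
apply: seg_int_norm_le => [||s sw].
- by apply: within_continuousB; exact: green_op_integrand_cont.
- by apply: within_continuousM => //; exact: within_cst.
- rewrite -mulrBl normrM; apply: ler_pM => //; last exact: fM.
  exact: (Green_lipschitz Ggreen).
Qed.

Lemma green_op_derive1_le h t : continuous h -> periodic h w -> (forall s, 0 < h s) ->
  `|derive1 (green_op h) t| <= dGmax w G * \int[mu]_(s in seg) h s.
Proof.
move=> ch ph h0; apply: (periodic_derive1_le w_gt0) => [|s|a c aw cw].
- exact: green_op_periodic.
- by have [_ /(_ s)[]] := green_op_solution h ch ph h0.
- apply: green_op_lipschitz => //; last exact: continuous_subspaceT.
  by move=> s _; rewrite gtr0_norm.
Qed.

(** The difference of the sources may change sign, so [green_repr] does not apply to it. Its image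
    is derivable as a difference of two solutions, and the derivative bound follows from the
    Lipschitz estimate. *)
Lemma green_op_dist h1 h2 M t :
  continuous h1 -> periodic h1 w -> (forall s, 0 < h1 s) ->
  continuous h2 -> periodic h2 w -> (forall s, 0 < h2 s) ->
  (forall s, 0 <= s <= w -> `|h1 s - h2 s| <= M) ->
  `|green_op h1 t - green_op h2 t| <= Gmax w G * (M * w) /\
  `|derive1 (green_op h1) t - derive1 (green_op h2) t| <= dGmax w G * (M * w).
Proof.
move=> c1 p1 h10 c2 p2 h20 h12.
have c12 : continuous (fun s => h1 s - h2 s).
  by move=> s; apply: cvgB; [exact: c1|exact: c2].
have [_ /all_and2[d1 _] _] := green_op_solution h1 c1 p1 h10.
have [_ /all_and2[d2 _] _] := green_op_solution h2 c2 p2 h20.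
split; first by rewrite -gopB //; exact: green_op_norm_le.
have gB : green_op (fun s => h1 s - h2 s) = green_op h1 \- green_op h2.
  by apply/funext => s; exact: gopB.
have -> : derive1 (green_op h1) t - derive1 (green_op h2) t =
    derive1 (green_op (fun s => h1 s - h2 s)) t.
  by rewrite gB !derive1E deriveB.
apply: (periodic_derive1_le w_gt0) => [|s|a c aw cw].
- exact: green_op_periodic.
- by rewrite gB; apply: derivableB.
- rewrite -(seg_int_cst w_gt0); apply: green_op_lipschitz => //.
  exact: within_cst.
Qed.

End GreenOp.

(** * Compactness *)

(** The reason for ultrafilters: a single [U] makes Th_n(t) and (Th_n)'(t) converge for all [t] at
    once, where subsequences would call for a diagonal extraction. *)
Lemma ultra_bounded_cvg {R : realType} (U : set_system nat) (f : nat -> R) (C : R) :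
  UltraFilter U -> (forall n, `|f n| <= C) -> cvg (f @ U).
Proof.
move=> UU fC; have : compact `[(- C), C] by exact: segment_compact.
rewrite compact_ultra => /(_ (f @ U)) [||l [_ fl]]; last by apply/cvg_ex; exists l.
  split=> [|H HH UH]; first exact: fmap_proper_filter.
  apply/seteqP; split => A HA; last exact: UH.
  have [//|UnA] := in_ultra_setVsetC (f @^-1` A) UU.
  have HnA : H (~` A) by apply: UH.
  by have [x []] := filter_ex (filterI HA HnA).
by apply: (@filterE _ U) => n /=; rewrite in_itv /= -ler_norml.
Qed.

(* Heine-Cantor, with the second point allowed to leave the compact set. *)
Lemma compact_uniform_continuity {R : realType} {T : pseudoMetricType R}
    (f : T -> R) (K : set T) (eps : R) :
  continuous f -> compact K -> 0 < eps ->
  exists2 eta : R, 0 < eta & forall x, K x -> forall y, ball x eta y -> `|f x - f y| <= eps.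
Proof.
move=> cf /compact_near_coveringP Kc eps0.
have Kuc : \forall e \near (0 : R)^'+,
    forall x, K x -> forall y, ball x e y -> `|f x - f y| <= eps.
  apply: (Kc _ _ (fun e x => forall y, ball x e y -> `|f x - f y| <= eps)) => x Kx.
  have : \forall z \near x, `|f x - f z| <= eps / 2.
    by move: (cf x) => /cvgrPdist_le; apply; rewrite divr_gt0.
  move=> /nbhs_ballP[d /= d0 xd].
  exists (ball x (d / 2), [set e | e < d / 2]) => /=.
    by split; [apply: nbhsx_ballx|apply: nbhs_right_lt]; rewrite divr_gt0.
  move=> [z e] /= [xz ed] y zy.
  have fy : `|f x - f y| <= eps / 2 := xd y (ball_split xz (le_ball (ltW ed) zy)).
  have d2 : d / 2 <= d by lra.
  have fz : `|f x - f z| <= eps / 2 := xd z (le_ball d2 xz).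
  apply: le_trans (ler_distD (f x) _ _) _.
  by rewrite [eps]splitr distrC lerD.
near (0 : R)^'+ => e; exists e; first by near: e; exact: nbhs_right_gt.
by near: e; exact: Kuc.
Unshelve. all: by end_near. Qed.

Section DistanceToPeriods.
Context {R : realType} {w : R}.
Hypothesis w_gt0 : 0 < w.

(** The distance from [t] to the lattice of multiples of [w]. Unlike [rem_period] it is continuous,
    so periodic hat functions can be built from it. *)
Definition dperiod (t : R) : R := Num.min (rem_period (w := w) t) (w - rem_period (w := w) t).

Lemma dperiod_le t m : dperiod t <= `|t - w *~ m|.
Proof.
have /andP[r0 rw] := rem_period_bounds w_gt0 t.
have -> : t - w *~ m = rem_period (w := w) t + w *~ (Num.floor (t / w) - m).
  by rewrite /rem_period mulrzBr addrA subrK.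
rewrite /dperiod ge_min; case: (leP 0 (Num.floor (t / w) - m)) => [z0|z0].
  have wz : 0 <= w *~ (Num.floor (t / w) - m) by rewrite mulrz_ge0// ltW.
  by apply/orP; left; rewrite ger0_norm; lra.
have wz : w *~ (Num.floor (t / w) - m) <= - w.
  by rewrite -[- w]mulN1r -mulrzl ler_wpM2r ?(ltW w_gt0)// -[-1]/((-1)%:~R) ler_int -ltzD1 addNr.
by apply/orP; right; rewrite ler0_norm; lra.
Qed.

Lemma dperiod_near t : exists m : int, dperiod t = `|t - w *~ m|.
Proof.
have /andP[r0 rw] := rem_period_bounds w_gt0 t.
rewrite /dperiod; have [_|_] := leP (rem_period (w := w) t) (w - rem_period (w := w) t).
  by exists (Num.floor (t / w)); rewrite -/(rem_period _) ger0_norm.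
exists (Num.floor (t / w) + 1).
have -> : t - w *~ (Num.floor (t / w) + 1) = rem_period (w := w) t - w.
  by rewrite /rem_period mulrzDr mulr1z opprD addrA.
by rewrite distrC ger0_norm // subr_ge0 ltW.
Qed.

Lemma dperiod_lipschitz t s : `|dperiod t - dperiod s| <= `|t - s|.
Proof.
wlog ts : t s / dperiod s <= dperiod t => [H|].
  have [/H|/ltW/H] := leP (dperiod s) (dperiod t); first by [].
  by rewrite distrC (distrC t).
rewrite ger0_norm ?subr_ge0// lerBlDr.
have [m ->] := dperiod_near s.
apply: (le_trans (dperiod_le t m)).
by rewrite (le_trans _ (ler_normD _ _))// addrA subrK.
Qed.

Lemma dperiod_continuous : continuous dperiod.
Proof.
move=> t; apply/cvgrPdist_le => e e0; near=> s.
apply: (le_trans (dperiod_lipschitz _ _)).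
by near: s; apply: cvgr_dist_le.
Unshelve. all: by end_near. Qed.

Lemma dperiod_periodic : periodic dperiod w.
Proof. by move=> t; rewrite /dperiod rem_period_periodic. Qed.

End DistanceToPeriods.

(** * Fixed points of a superposition operator *)

(** Indices of weight zero are exempt from the bounds: this is how a partition of unity localizes an
    estimate. *)
Lemma weighted_mean_bounds {R : realType} {I : finType} (mu a : I -> R) (lo hi : R) :
  (forall i, 0 <= mu i) -> 0 < \sum_i mu i ->
  (forall i, 0 < mu i -> lo <= a i <= hi) ->
  lo <= (\sum_i mu i * a i) / (\sum_i mu i) <= hi.
Proof.
move=> mu0 smu aP; rewrite ler_pdivlMr// ler_pdivrMr// !mulr_sumr.
have aP' i : lo * mu i <= mu i * a i <= hi * mu i.
  have := mu0 i; rewrite le_eqVlt => /predU1P[<-|mui]; first by rewrite !mul0r !mulr0 lexx.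
  by rewrite ![_ * mu i]mulrC !ler_pM2l //; exact: aP.
by apply/andP; split; apply: ler_sum => i _; have /andP[] := aP' i.
Qed.

Lemma dist_trans {R : realType} (b a c x y : R) :
  `|a - b| <= x -> `|b - c| <= y -> `|a - c| <= x + y.
Proof. by move=> ab bc; apply: le_trans (ler_distD b a c) (lerD ab bc). Qed.

Lemma derivable_continuous {R : realType} (f : R -> R) :
  (forall t, derivable f t 1) -> continuous f.
Proof. by move=> df t; apply/differentiable_continuous/derivable1_diffP. Qed.

Lemma periodic_bounded {R : realType} {w : R} (f : R -> R) : 0 < w ->
  continuous f -> periodic f w -> exists2 C, 0 <= C & forall t, `|f t| <= C.
Proof.
move=> w0 cf pf.
have /EVT_max[|c _ cmax] : {within `[0, w], continuous (fun t => `|f t|)}.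
- by apply: continuous_subspaceT => t; apply: cvg_norm; exact: cf.
- exact: ltW.
exists `|f c| => // t; rewrite (periodic_rem _ pf); apply: cmax.
by rewrite in_itv /=; have /andP[-> /ltW] := rem_period_bounds w0 t.
Qed.

Section FixedPoint.
Context {R : realType} {w : R} {p k : R -> R} {G : R -> R -> R}.
Hypothesis w_gt0 : 0 < w.
Hypothesis Ggreen : is_green w p k G.
Hypothesis G_gt0 : forall t s, 0 <= t <= w -> 0 <= s <= w -> 0 < G t s.
Hypotheses (cp : continuous p) (ck : continuous k).
Hypotheses (pp : periodic p w) (pk : periodic k w).
Context {g : R -> R -> R -> R} {m M : R}.
Hypothesis cg : continuous (fun z : R * R * R => g z.1.1 z.1.2 z.2).
Hypothesis pg : forall t y v, g (t + w) y v = g t y v.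
Hypotheses (m_gt0 : 0 < m) (mM : m <= M).

Definition source (h : R -> R) :=
  [/\ continuous h, periodic h w & forall s, m <= h s <= M].

Notation green_op := (green_op (w := w) (G := G)).

Definition nemytskii (h : R -> R) (t : R) := g t (green_op h t) (derive1 (green_op h) t).

Hypothesis nemytskii_bounds : forall h, source h -> forall t, m <= nemytskii h t <= M.

Lemma source_gt0 h : source h -> forall s, 0 < h s.
Proof. by move=> [_ _ hb] s; have /andP[+ _] := hb s; exact: lt_le_trans. Qed.

Lemma source_solution h : source h -> periodic_solution w p k h (green_op h).
Proof.
move=> hs; have [ch ph _] := hs.
by apply: (green_op_solution w_gt0 Ggreen) => //; exact: source_gt0.
Qed.

Lemma superposition_continuous (u v : R -> R) :
  continuous u -> continuous v -> continuous (fun t => g t (u t) (v t)).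
Proof.
move=> cu cv t.
have := @continuous_comp _ _ _ (fun t => (t, u t, v t))
  (fun z : R * R * R => g z.1.1 z.1.2 z.2) t.
apply; last exact: cg.
by apply: continuous_pair => //; apply: continuous_pair => // s; exact: cvg_id.
Qed.

Lemma nemytskii_source h : source h -> source (nemytskii h).
Proof.
move=> hs; have [ph /all_and2[d1 d2] _] := source_solution h hs.
split; last exact: nemytskii_bounds.
  by apply: superposition_continuous; exact: derivable_continuous.
by move=> t; rewrite /nemytskii pg ph periodic_derive1.
Qed.

Lemma seg_int_source h : source h ->
  0 <= \int[lebesgue_measure]_(s in `[0, w]) h s <= M * w.
Proof.
move=> hs; have [ch _ hM] := hs.
have ch' := continuous_subspaceT (A := `[0, w]) ch.
rewrite -(seg_int_cst w_gt0) -[X in X <= _](mul0r w) -(seg_int_cst w_gt0).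
apply/andP; split; apply: seg_int_le => //; try exact: within_cst.
  by move=> s _; rewrite ltW ?source_gt0.
by move=> s _; have /andP[] := hM s.
Qed.

Lemma Gmax_dGmax_ge0 : 0 <= Gmax w G /\ 0 <= dGmax w G.
Proof.
split.
  by rewrite (le_trans (ltW (G_gt0 0 0 _ _)) (Gmax_ge w_gt0 Ggreen _ _ _ _))// lexx ltW.
have w2 : 0 < w / 2 < w by rewrite divr_gt0 //= ltr_pdivrMr // ltr_pMr // ltr1n.
have w0 : 0 <= (0 : R) <= w by rewrite lexx ltW.
have wn : w / 2 != 0 by rewrite gt_eqF// divr_gt0.
by have [_] := dGmax_ge Ggreen _ _ w2 w0 wn; exact: le_trans.
Qed.

(** The constant [L] comes from the equation itself: (Th)'' = h - p (Th)' - k Th, and each term is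
    bounded uniformly over all sources. *)
Lemma source_estimates : exists Y V L : R, [/\ 0 <= Y, 0 <= V, 0 <= L &
  forall h, source h -> [/\ forall t, `|green_op h t| <= Y,
    forall t, `|derive1 (green_op h) t| <= V,
    forall t s, `|green_op h t - green_op h s| <= V * `|t - s|
  & forall t s, `|derive1 (green_op h) t - derive1 (green_op h) s| <= L * `|t - s|]].
Proof.
have [P P0 Pb] := periodic_bounded _ w_gt0 cp pp.
have [K K0 Kb] := periodic_bounded _ w_gt0 ck pk.
have M0 : 0 <= M by rewrite (le_trans (ltW m_gt0)).
have [Gmax0 dG0] := Gmax_dGmax_ge0.
pose Y := Gmax w G * (M * w); pose V := dGmax w G * (M * w).
have Y0 : 0 <= Y by rewrite mulr_ge0// mulr_ge0// ltW.
have V0 : 0 <= V by rewrite mulr_ge0// mulr_ge0// ltW.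
exists Y, V, (M + P * V + K * Y); split => //.
  by rewrite !addr_ge0// mulr_ge0.
move=> h hs; have [ch ph hM] := hs.
have /andP[I0 IM] := seg_int_source h hs.
have [_ /all_and2[d1 d2] eqn] := source_solution h hs.
have uY t : `|green_op h t| <= Y.
  apply: (green_op_norm_le w_gt0 Ggreen G_gt0) => // s _.
  by rewrite gtr0_norm ?source_gt0//; have /andP[] := hM s.
have uV t : `|derive1 (green_op h) t| <= V.
  apply: (le_trans (green_op_derive1_le w_gt0 Ggreen h t ch ph (source_gt0 h hs))).
  by rewrite ler_wpM2l.
split => //; first exact: lipschitz_derive1.
apply: lipschitz_derive1 => // t.
have -> : derive1 (derive1 (green_op h)) t =
    h t - p t * derive1 (green_op h) t - k t * green_op h t.
  by rewrite -(eqn t) /linop /derive1n /=; lra.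
apply: (le_trans (ler_normB _ _)); apply: lerD; last by rewrite normrM ler_pM.
apply: (le_trans (ler_normB _ _)); apply: lerD; last by rewrite normrM ler_pM.
by rewrite gtr0_norm ?source_gt0//; have /andP[] := hM t.
Qed.

Lemma superposition_uniform Y V eps : 0 < eps -> exists2 eta : R, 0 < eta &
  forall t y v, 0 <= t <= w -> `|y| <= Y -> `|v| <= V ->
  forall t' y' v', `|t - t'| < eta -> `|y - y'| < eta -> `|v - v'| < eta ->
  `|g t y v - g t' y' v'| <= eps.
Proof.
move=> eps0.
have Kc : compact (`[0, w] `*` `[- Y, Y] `*` `[- V, V] : set (R * R * R)).
  by apply: compact_setX; [apply: compact_setX|]; exact: segment_compact.
have [eta eta0 etaP] := compact_uniform_continuity _ _ _ cg Kc eps0.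
exists eta => // t y v tw yY vV t' y' v' tt' yy' vv'.
apply: (etaP (t, y, v) _ (t', y', v')); last by split => //; split.
by split; [split|]; rewrite /= in_itv //= -ler_norml.
Qed.

Lemma nemytskii_equicontinuous eps : 0 < eps -> exists2 eta : R, 0 < eta &
  forall h, source h -> forall t s, 0 <= t <= w -> `|t - s| < eta ->
  `|nemytskii h t - nemytskii h s| <= eps.
Proof.
move=> eps0; have [Y [V [L [Y0 V0 L0 est]]]] := source_estimates.
have [d d0 dP] := superposition_uniform Y V eps eps0.
(* 1, [V] and [L] are Lipschitz constants of the three arguments t, Th and (Th)' of [g], so none of
   them moves by [d] when [t] moves by less than d / C. *)
pose C := 1 + V + L.
have C0 : 0 < C by rewrite /C; lra.
exists (d / C); first by rewrite divr_gt0.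
move=> h hs t s tw; rewrite ltr_pdivlMr// => ts.
have [uY uV uL vL] := est h hs.
have ts0 := normr_ge0 (t - s).
have VL : 0 <= V * `|t - s| by rewrite mulr_ge0.
have LL : 0 <= L * `|t - s| by rewrite mulr_ge0.
apply: dP => //.
- by rewrite /C in ts; lra.
- by apply: le_lt_trans (uL _ _) _; rewrite /C in ts; lra.
- by apply: le_lt_trans (vL _ _) _; rewrite /C in ts; lra.
Qed.

Lemma nemytskii_almost_fixed eps : 0 < eps -> exists2 h, source h &
  forall t, 0 <= t <= w -> `|h t - nemytskii h t| <= eps.
Proof.
move=> eps0; have e2 : 0 < eps / 2 by rewrite divr_gt0.
have [eta eta0 etaP] := nemytskii_equicontinuous (eps / 2) e2.
have [n nP] : exists n : nat, w / n.+1%:R < eta.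
  exists (Num.trunc (w / eta)); have := truncnS_gt (w / eta).
  by rewrite ltr_pdivrMr// ltr_pdivrMr ?ltr0n// mulrC.
pose node (i : 'I_n.+1) : R := w * i%:R / n.+1%:R.
(* Hat functions of radius [eta] around equispaced nodes, made periodic by [dperiod]. The spacing is
   smaller than [eta], so the node just left of [t] modulo [w] always has positive weight and the
   sum never vanishes. *)
pose mu i t := Num.max 0 (eta - dperiod (w := w) (t - node i)).
have mu0 i t : 0 <= mu i t by rewrite le_max lexx.
have node_seg i : 0 <= node i <= w.
  have w0 := ltW w_gt0.
  rewrite /node divr_ge0 ?mulr_ge0 //= ler_pdivrMr ?ltr0n// ler_wpM2l //.
  by rewrite ler_nat ltnW.
have smu t : 0 < \sum_i mu i t.
  have /andP[r0 rw] := rem_period_bounds w_gt0 t.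
  set r := rem_period t in r0 rw.
  have x0 : 0 <= r * n.+1%:R / w by rewrite divr_ge0 ?mulr_ge0// ltW.
  have /andP[jl jr] := truncn_itv x0.
  set j := Num.trunc _ in jl jr.
  have jn : (j < n.+1)%N.
    rewrite -(ltr_nat R) (le_lt_trans jl)// ltr_pdivrMr// mulrC ltr_pM2l//.
  have nj : node (Ordinal jn) <= r.
    by rewrite /node /= ler_pdivrMr ?ltr0n// mulrC -ler_pdivlMr //.
  have rj : r - node (Ordinal jn) <= w / n.+1%:R.
    rewrite /node /= lerBlDl -mulrDl ler_pdivlMr ?ltr0n//.
    have -> : w * j%:R + w = j.+1%:R * w by rewrite -natr1 mulrDl mul1r mulrC.
    by rewrite -ler_pdivrMr //; exact: ltW.
  have mj : 0 < mu (Ordinal jn) t.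
    rewrite /mu lt_max ltxx /= subr_gt0.
    apply: le_lt_trans (dperiod_le w_gt0 _ (Num.floor (t / w))) _.
    by rewrite addrAC -/r ger0_norm ?subr_ge0// (le_lt_trans rj).
  by rewrite (bigD1 (Ordinal jn)) //=; apply: ltr_wpDr => //; apply: sumr_ge0.
have cmu i : continuous (mu i).
  move=> t; apply: (continuous_max (f := fun=> 0)
    (g := fun t => eta - dperiod (w := w) (t - node i))); first exact: cvg_cst.
  apply: cvgB; first exact: cvg_cst.
  apply: (@continuous_comp _ _ _ (fun t => t - node i) (dperiod (w := w))).
    by apply: cvgB; [exact: cvg_id|exact: cvg_cst].
  exact: dperiod_continuous.
have pmu i t : mu i (t + w) = mu i t by rewrite /mu addrAC dperiod_periodic.
pose H a t := (\sum_i mu i t * a i) / (\sum_i mu i t).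
have HD a b t : H a t - H b t = H (fun i => a i - b i) t.
  rewrite /H -mulrBl -sumrB; congr (_ / _).
  by apply: eq_bigr => i _; rewrite mulrBr.
have Hs a : (forall i, m <= a i <= M) -> source (H a).
  move=> ab; split => [t|t|t]; last exact: weighted_mean_bounds.
    have csum (f : 'I_n.+1 -> R -> R) : (forall i, continuous (f i)) ->
        continuous (fun s => \sum_i f i s).
      by move=> cf; apply: continuous_big => // z; exact: add_continuous.
    apply: cvgM; first by apply: csum => i s; apply: cvgM; [exact: cmu|exact: cvg_cst].
    by apply: cvgV; [rewrite gt_eqF|exact: csum].
  rewrite /H; congr (_ / _); last by apply: eq_bigr => i _.
  by apply: eq_bigr => i _; rewrite pmu.
pose Phi a i := nemytskii (H a) (node i).
have [| | |a ab aP] := @brouwer_approx R n.+1 m M Phi _ _ _ (eps / 2) e2 => //.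
- by move=> a ab i; apply: nemytskii_bounds; exact: Hs.
- move=> e e0; have [Y [V [L [Y0 V0 L0 est]]]] := source_estimates.
  have [d d0 dP] := superposition_uniform Y V e e0.
  have [Gm0 dG0] := Gmax_dGmax_ge0.
  (* Coefficients within d / C give sources within d / C, and by [green_op_dist] both Th and (Th)'
     then move by less than [d]. *)
  pose C := (Gmax w G + dGmax w G) * w + 1.
  have C0 : 0 < C by rewrite ltr_wpDl// mulr_ge0 ?addr_ge0// ltW.
  exists (d / C); first by rewrite divr_gt0.
  move=> a b ab bb close i.
  have [ca pa _] := Hs a ab; have [cb pb _] := Hs b bb.
  have Hclose s : 0 <= s <= w -> `|H a s - H b s| <= d / C.
    by move=> _; rewrite HD ler_norml weighted_mean_bounds// => j _; rewrite -ler_norml.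
  have [uY uV _ _] := est _ (Hs a ab).
  have [du dv] := green_op_dist w_gt0 Ggreen G_gt0 _ _ _ (node i) ca pa
    (source_gt0 _ (Hs a ab)) cb pb (source_gt0 _ (Hs b bb)) Hclose.
  have small c : 0 <= c -> c <= Gmax w G + dGmax w G -> c * (d / C * w) < d.
    move=> c0 cC; rewrite mulrCA -mulrA [_^-1 * _]mulrC mulrA ltr_pdivrMr//.
    rewrite ltr_pM2l// /C; apply: (@le_lt_trans _ _ ((Gmax w G + dGmax w G) * w)).
      by rewrite ler_wpM2r// ltW.
    by rewrite ltrDl.
  apply: dP => //; first by rewrite subrr normr0.
    by apply: le_lt_trans du (small _ _ _) => //; rewrite lerDl.
  by apply: le_lt_trans dv (small _ _ _) => //; rewrite lerDr.
exists (H a); first exact: Hs.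
move=> t tw.
(* The normalized weights sum to 1, so the constant goes under the mean. Only nodes within [eta] of
   [t] modulo [w] count; there eps / 2 comes from Brouwer's approximation and eps / 2 from
   equicontinuity. *)
have -> : H a t - nemytskii (H a) t = H (fun i => a i - nemytskii (H a) t) t.
  rewrite -[LHS]/(_ - _) -HD; congr (_ - _).
  by rewrite /H -mulr_suml mulrAC mulfV ?mul1r// gt_eqF.
rewrite ler_norml; apply: weighted_mean_bounds => // i.
rewrite lt_max ltxx /= subr_gt0.
have [z ->] := dperiod_near w_gt0 (t - node i) => tz.
have := etaP (H a) (Hs a ab) t (node i + w *~ z) tw.
rewrite opprD addrA => /(_ tz).
have [_ pn _] := nemytskii_source (H a) (Hs a ab).
rewrite (periodicz _ pn) distrC => tn.
rewrite -ler_norml [eps]splitr; apply: dist_trans tn.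
by rewrite distrC; exact: aP.
Qed.

Lemma lipschitz_continuous (f : R -> R) (C : R) :
  (forall t s, `|f t - f s| <= C * `|t - s|) -> continuous f.
Proof.
move=> fC t; apply/cvgrPdist_le => e e0; near=> s.
apply: (le_trans (fC t s)).
have D0 : 0 < `|C| + 1 by rewrite ltr_wpDl.
apply: (@le_trans _ _ ((`|C| + 1) * `|t - s|)).
  by rewrite ler_wpM2r// (le_trans (ler_norm C))// lerDl.
rewrite mulrC -ler_pdivlMr//; near: s; apply: cvgr_dist_le; first exact: cvg_id.
by rewrite divr_gt0.
Unshelve. all: by end_near. Qed.

(** The approximate fixed points h_n come without a common modulus of continuity, but their images
    have one. The limits y and v of Th_n and (Th_n)' therefore define h0 = g(., y, v); the images,
    hence also the h_n, converge to h0 uniformly, and continuity of T identifies y with T h0 and v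
    with (T h0)'. *)
Lemma nemytskii_fixed_point : exists2 h, source h & forall t, h t = nemytskii h t.
Proof.
have /choice[hn hnP] (n : nat) : exists h, source h /\
    forall t, 0 <= t <= w -> `|h t - nemytskii h t| <= n.+1%:R^-1.
  have n0 : (0 : R) < n.+1%:R^-1 by rewrite invr_gt0.
  by have [h hs hP] := nemytskii_almost_fixed _ n0; exists h.
have hns n : source (hn n) by have [] := hnP n.
have [U [UU Uoo]] := ultraFilterLemma (T := nat) (F := \oo) _.
have UF : ProperFilter U by exact: ultra_proper.
have [Y [V [L [Y0 V0 L0 est]]]] := source_estimates.
pose y t := lim (green_op (hn n) t @[n --> U]).
pose v t := lim (derive1 (green_op (hn n)) t @[n --> U]).
have yc t : green_op (hn n) t @[n --> U] --> y t.
  by apply: (@ultra_bounded_cvg _ _ _ Y) => n; have [] := est _ (hns n).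
have vc t : derive1 (green_op (hn n)) t @[n --> U] --> v t.
  by apply: (@ultra_bounded_cvg _ _ _ V) => n; have [] := est _ (hns n).
have cy : continuous y.
  apply: (lipschitz_continuous _ V) => t s.
  apply: (cvgr_to_le (cvg_norm (cvgB (yc t) (yc s)))).
  by apply: nearW => n; have [_ _ + _] := est _ (hns n); apply.
have cv : continuous v.
  apply: (lipschitz_continuous _ L) => t s.
  apply: (cvgr_to_le (cvg_norm (cvgB (vc t) (vc s)))).
  by apply: nearW => n; have [_ _ _] := est _ (hns n); apply.
pose h0 t := g t (y t) (v t).
have h0c t : nemytskii (hn n) t @[n --> U] --> h0 t.
  apply: (@cvg_comp _ _ _ (fun n => (t, green_op (hn n) t, derive1 (green_op (hn n)) t))
    (fun z : R * R * R => g z.1.1 z.1.2 z.2) _ _ _ _ (cg (t, y t, v t))).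
  apply: (@cvg_pair _ _ _ _ (nbhs (t, y t)) (nbhs (v t))) => //.
  by apply: (@cvg_pair _ _ _ _ (nbhs t) (nbhs (y t))) => //; exact: cvg_cst.
have h0s : source h0.
  split; first exact: superposition_continuous.
    have py t : y (t + w) = y t.
      have E : (fun n => green_op (hn n) (t + w)) = (fun n => green_op (hn n) t).
        by apply/funext => n; exact: green_op_periodic.
      exact: (congr1 (fun f => lim (f @ U)) E).
    have pv t : v (t + w) = v t.
      have E : (fun n => derive1 (green_op (hn n)) (t + w)) = (fun n => derive1 (green_op (hn n)) t).
        apply/funext => n; apply: periodic_derive1; exact: green_op_periodic.
      exact: (congr1 (fun f => lim (f @ U)) E).
    by move=> t; rewrite /h0 pg py pv.
  move=> t; apply/andP; split.
    apply: (cvgr_to_ge (h0c t)); apply: nearW => n.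
    by have /andP[] := nemytskii_bounds _ (hns n) t.
  apply: (cvgr_to_le (h0c t)); apply: nearW => n.
  by have /andP[] := nemytskii_bounds _ (hns n) t.
(* Pointwise convergence becomes uniform: equicontinuity spreads the estimate at [t] to a
   neighbourhood, and compactness of the period leaves finitely many conditions on [n]. *)
have unif e : 0 < e -> \forall n \near U, forall t, 0 <= t <= w ->
    `|nemytskii (hn n) t - h0 t| <= e.
  move=> e0; have e3 : 0 < e / 3 by rewrite divr_gt0.
  have [eta eta0 etaP] := nemytskii_equicontinuous (e / 3) e3.
  have /compact_near_coveringP Kc := @segment_compact R 0 w.
  have Knear : \forall n \near U, `[0, w] `<=`
      [set t | 0 <= t <= w -> `|nemytskii (hn n) t - h0 t| <= e].
    apply: (Kc _ U (fun n t => 0 <= t <= w ->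
      `|nemytskii (hn n) t - h0 t| <= e)) => t.
    rewrite /= in_itv /= => tw.
    have ch0 : continuous h0 by have [] := h0s.
    exists ([set s | `|t - s| < eta /\ `|h0 t - h0 s| <= e / 3],
      [set n | `|nemytskii (hn n) t - h0 t| <= e / 3]) => /=.
      split.
        near=> s; split; near: s; first exact: cvgr_dist_lt.
        by move: (ch0 t) => /cvgrPdist_le; apply.
      have := h0c t; move=> /cvgrPdist_le /(_ _ e3).
      by apply: filterS => n; rewrite distrC.
    move=> [s n] /= [[ts h0ts] nt] _.
    have -> : e = e / 3 + (e / 3 + e / 3) by field.
    apply: (dist_trans (nemytskii (hn n) t)).
      by rewrite distrC; exact: etaP.
    exact: dist_trans nt h0ts.
  by move: Knear; apply: filterS => n Kn t tw; apply: Kn; rewrite /= ?in_itv.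
have hunif e : 0 < e -> \forall n \near U, forall t, 0 <= t <= w -> `|hn n t - h0 t| <= e.
  move=> e0; have e2 : 0 < e / 2 by rewrite divr_gt0.
  have n_small : \forall n \near U, n.+1%:R^-1 <= e / 2.
    apply: Uoo; near=> n; apply: ltW.
    by near: n; exact: (near_infty_natSinv_lt (PosNum e2)).
  apply: filterS2 (unif _ e2) n_small => n un ne t tw.
  apply: le_trans (ler_distD (nemytskii (hn n) t) _ _) _.
  rewrite [e]splitr; apply: lerD; last exact: un.
  by have [_ /(_ t tw)] := hnP n; move/le_trans; apply.
have [ch0 ph0 _] := h0s.
(* [F] is evaluation of Th or of (Th)' at a point, and [C] the constant of [green_op_dist]. *)
have lim_eq (F : (R -> R) -> R) (l C : R) : 0 <= C ->
    F (hn n) @[n --> U] --> l ->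
    (forall n e, (forall t, 0 <= t <= w -> `|hn n t - h0 t| <= e) ->
       `|F (hn n) - F h0| <= C * (e * w)) -> l = F h0.
  move=> C0 Fl FC; apply: (cvg_unique _ Fl) => //.
  apply/cvgrPdist_le => e e0.
  have D0 : 0 < C * w + 1 by rewrite ltr_wpDl// mulr_ge0// ltW.
  have : 0 < e / (C * w + 1) by rewrite divr_gt0.
  move=> /hunif; apply: filterS => n /FC.
  rewrite distrC => /le_trans; apply.
  have -> : C * (e / (C * w + 1) * w) = e * (C * w / (C * w + 1)).
    by rewrite -[e / _ * w]mulrA mulrCA [_^-1 * w]mulrC [C * (_ * _)]mulrA.
  by rewrite ler_piMr ?(ltW e0)// ler_pdivrMr// mul1r lerDl.
have [Gm0 dG0] := Gmax_dGmax_ge0.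
have dist n e t := fun H => green_op_dist w_gt0 Ggreen G_gt0 (hn n) h0 e t
  (let: And3 c _ _ := hns n in c) (let: And3 _ c _ := hns n in c)
  (source_gt0 _ (hns n)) ch0 ph0 (source_gt0 _ h0s) H.
exists h0 => // t.
rewrite /nemytskii /h0; congr (g _ _ _).
  apply: (lim_eq (fun h => green_op h t) _ _ Gm0 (yc t)) => n e H.
  by have [] := dist n e t H.
apply: (lim_eq (fun h => derive1 (green_op h) t) _ _ dG0 (vc t)) => n e H.
by have [] := dist n e t H.
Unshelve. all: by end_near. Qed.

End FixedPoint.

(** * Powers *)

Lemma lower_attained {R : realType} {w : R} (f : R -> R) : 0 < w ->
  continuous f -> periodic f w ->
  (exists t0, lower w f = f t0) /\ forall t, lower w f <= f t.
Proof.
move=> w0 cf pf.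
have [|t0 t0w fmin] := @EVT_min R f 0 w (ltW w0).
  exact: continuous_subspaceT.
have E : lower w f = f t0.
  apply/eqP; rewrite eq_le; apply/andP; split.
    apply: ge_inf; last by exists t0.
    by exists (f t0) => _ [t tw <-]; apply: fmin.
  apply: lb_le_inf; first by exists (f t0), t0.
  by move=> _ [t tw <-]; apply: fmin.
split; first by exists t0.
move=> t; rewrite E (periodic_rem _ pf t); apply: fmin.
by rewrite in_itv /=; have /andP[-> /ltW] := rem_period_bounds w0 t.
Qed.

Section Powers.
Context {R : realType}.
Implicit Types (a x y z : R).

Lemma powR_cvg {T : topologicalType} (f : T -> R) a (x : T) :
  {for x, continuous f} -> 0 < f x -> {for x, continuous (fun t => f t `^ a)}.
Proof.
move=> cf fx; have cp : {for f x, continuous ((@powR R)^~ a)}.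
  apply/differentiable_continuous/derivable1_diffP.
  by have [] := is_derive1_powR a fx.
exact: (continuous_comp cf cp).
Qed.

Lemma ler_powRN a x y : a <= 0 -> 0 < x -> x <= y -> y `^ a <= x `^ a.
Proof.
move=> a0 x0 xy; rewrite -[a]opprK powRN [x `^ _]powRN.
rewrite lef_pV2 ?posrE ?powR_gt0 ?(lt_le_trans x0)//.
by apply: ge0_ler_powR; rewrite ?nnegrE ?oppr_ge0 ?(ltW x0) ?(le_trans (ltW x0)).
Qed.

Lemma powR_subr1 a x : 0 < x -> x `^ a = x `^ (a - 1) * x.
Proof.
move=> x0; rewrite -[X in _ * X](powRr1 (ltW x0)) -powRD ?subrK//.
by rewrite (gt_eqF x0) implybT.
Qed.

Lemma powR_sublinear a : 0 < a < 1 -> forall eps : R, 0 < eps ->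
  exists2 C, 0 <= C & forall x, 0 <= x -> x `^ a <= eps * x + C.
Proof.
move=> /andP[a0 a1] eps eps0.
(* The threshold solves A^(a - 1) = eps; beyond it x^(a - 1) <= eps because a - 1 < 0. *)
pose A := eps `^ (a - 1)^-1.
have A0 : 0 < A by rewrite powR_gt0.
have a10 : a - 1 < 0 by rewrite subr_lt0.
exists (A `^ a); first exact: powR_ge0.
move=> x x0; have [xA|Ax] := leP x A.
  apply: (@le_trans _ _ (A `^ a)); last by rewrite lerDr mulr_ge0// ltW.
  by apply: ge0_ler_powR; rewrite ?nnegrE // ltW.
have x_gt0 : 0 < x := lt_trans A0 Ax.
apply: (@le_trans _ _ (eps * x)); last by rewrite lerDl powR_ge0.
rewrite powR_subr1 // ler_wpM2r//.
apply: le_trans (ler_powRN _ _ _ (ltW a10) A0 (ltW Ax)) _.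
by rewrite /A -powRrM mulVf ?lt_eqF// powRr1 // ltW.
Qed.

End Powers.

(** * The change of unknown x = y^a *)

Section PowerSubstitution.
Context {R : realType}.
Variables (y : R -> R).
Hypothesis y_gt0 : forall t, 0 < y t.
Hypothesis dy : twice_derivable y.

Lemma is_derive_power (a t : R) :
  is_derive t 1 (fun s => y s `^ a) (a * y t `^ (a - 1) * derive1 y t).
Proof.
have [d1 _] := dy t.
have yd : is_derive t 1 y (derive1 y t) by rewrite derive1E; exact/derivableP.
exact: (is_derive1_comp (is_derive1_powR a (y_gt0 t)) yd).
Qed.

Lemma derive1_power (a : R) :
  derive1 (fun s => y s `^ a) = fun t => a * y t `^ (a - 1) * derive1 y t.
Proof. by apply/funext => t; have [_ <-] := is_derive_power a t; rewrite derive1E. Qed.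

Lemma is_derive_power2 (a t : R) :
  is_derive t 1 (derive1 (fun s => y s `^ a))
    (a * y t `^ (a - 1) *
      (derive1n 2 y t - (1 - a) * (`|derive1 y t| ^+ 2 / y t))).
Proof.
have [_ d2] := dy t.
have yd : is_derive t 1 (derive1 y) (derive1n 2 y t).
  by rewrite /derive1n /= derive1E; exact/derivableP.
rewrite derive1_power.
have pd := is_derive_power (a - 1) t.
have := is_deriveM (is_deriveZ a pd) yd.
move=> H; apply: (is_derive_eq H).
rewrite /GRing.scale /= real_normK ?num_real //.
have yn0 : y t != 0 by rewrite gt_eqF.
rewrite (powR_subr1 (a - 1) _ (y_gt0 t)).
have scaleE (u v : R) : u *: (v : R^o) = u * v by [].
by rewrite ?scaleE; field.
Qed.

Lemma power_twice_derivable (a : R) : twice_derivable (fun t => y t `^ a).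
Proof.
by move=> t; split; [have [] := is_derive_power a t|have [] := is_derive_power2 a t].
Qed.

(* The singular term (y')^2 / y is exactly what the substitution x = y^a produces. *)
Lemma linop_power (a t : R) (p q : R -> R) : a != 0 ->
  linop p q (fun s => y s `^ a) t = a * y t `^ (a - 1) *
    (linop p (fun s => q s / a) y t - (1 - a) * (`|derive1 y t| ^+ 2 / y t)).
Proof.
move=> a0; rewrite /linop.
have [_ x2] := is_derive_power2 a t.
have -> : derive1n 2 (fun s => y s `^ a) t = 'D_1 (derive1 (fun s => y s `^ a)) t.
  by rewrite /derive1n /= derive1E.
rewrite x2 derive1_power.
have yn0 : y t != 0 by rewrite gt_eqF.
rewrite [y t `^ a]powR_subr1 //.
by field; rewrite a0 yn0.
Qed.

End PowerSubstitution.

(** * The cone *)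

Section SupNorm.
Context {R : realType} {w : R}.
Hypothesis w_gt0 : 0 < w.

Lemma supnorm_le (f : R -> R) C : (forall t, `|f t| <= C) -> supnorm w f <= C.
Proof.
move=> fC; apply: ge_sup; last by move=> _ [t _ <-].
by exists `|f 0|, 0; rewrite //= in_itv /= lexx ltW.
Qed.

Lemma supnorm_ge (f : R -> R) C t : (forall t, `|f t| <= C) -> 0 <= t <= w ->
  `|f t| <= supnorm w f.
Proof.
move=> fC tw; apply: ub_le_sup; last by exists t; rewrite //= in_itv.
by exists C => _ [s _ <-].
Qed.

Lemma supnorm_ge0 (f : R -> R) C : (forall t, `|f t| <= C) -> 0 <= supnorm w f.
Proof.
move=> fC; apply: le_trans (normr_ge0 (f 0)) (supnorm_ge _ C 0 fC _).
by rewrite lexx ltW.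
Qed.

End SupNorm.

Section Cone.
Context {R : realType} {w : R} {p k : R -> R} {G : R -> R -> R}.
Hypothesis w_gt0 : 0 < w.
Hypothesis Ggreen : is_green w p k G.
Hypothesis G_gt0 : forall t s, 0 <= t <= w -> 0 <= s <= w -> 0 < G t s.

Let Gmin0 := Gmin_gt0 w_gt0 Ggreen G_gt0.

Lemma Gmin_le_Gmax : Gmin w G <= Gmax w G.
Proof.
have w0 : 0 <= (0 : R) <= w by rewrite lexx ltW.
exact: le_trans (Gmin_le w_gt0 Ggreen _ _ w0 w0) (Gmax_ge w_gt0 Ggreen _ _ w0 w0).
Qed.

Lemma GdG_gt0 : 0 < Gmax w G + dGmax w G.
Proof.
have [_ d0] := Gmax_dGmax_ge0 w_gt0 Ggreen G_gt0.
by rewrite ltr_wpDr// (lt_le_trans Gmin0 Gmin_le_Gmax).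
Qed.

Lemma sigma_gt0 : 0 < sigma w G.
Proof. by rewrite divr_gt0// GdG_gt0. Qed.

Lemma sigma_le1 : sigma w G <= 1.
Proof.
rewrite ler_pdivrMr ?GdG_gt0// mul1r.
have [_ d0] := Gmax_dGmax_ge0 w_gt0 Ggreen G_gt0.
by rewrite (le_trans Gmin_le_Gmax)// lerDl.
Qed.

Lemma delta_ge0 : 0 <= delta w G.
Proof.
have [_ d0] := Gmax_dGmax_ge0 w_gt0 Ggreen G_gt0.
by rewrite divr_ge0// ltW.
Qed.

Variable h : R -> R.
Hypotheses (ch : continuous h) (ph : periodic h w) (h_gt0 : forall t, 0 < h t).
Notation u := (green_op (w := w) (G := G) h).
Notation I := (\int[lebesgue_measure]_(s in `[0, w]) h s).

Lemma source_int_ge (a : R) : (forall t, a <= h t) -> a * w <= I.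
Proof.
move=> ah; rewrite -(seg_int_cst w_gt0); apply: seg_int_le => //.
  exact: within_cst.
exact: continuous_subspaceT.
Qed.

Lemma source_int_le (a : R) : (forall t, h t <= a) -> I <= a * w.
Proof.
move=> ah; rewrite -(seg_int_cst w_gt0); apply: seg_int_le => //.
  exact: continuous_subspaceT.
exact: within_cst.
Qed.

Lemma source_int_gt0 : 0 < I.
Proof.
have [[t0 t0E] hmin] := lower_attained h w_gt0 ch ph.
apply: lt_le_trans (source_int_ge _ hmin).
by rewrite mulr_gt0// t0E.
Qed.

Lemma green_op_gt0 t : 0 < u t.
Proof.
apply: lt_le_trans (green_op_ge w_gt0 Ggreen h t ch h_gt0).
by rewrite mulr_gt0// source_int_gt0.
Qed.

Lemma green_op_norm_int t : `|u t| <= Gmax w G * I.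
Proof. by rewrite gtr0_norm ?green_op_gt0//; exact: (green_op_le w_gt0 Ggreen). Qed.

Lemma green_op_derive1_le_delta t : `|derive1 u t| <= delta w G * u t.
Proof.
apply: le_trans (green_op_derive1_le w_gt0 Ggreen h t ch ph h_gt0) _.
rewrite /delta -mulrA ler_wpM2l//.
  by have [_] := Gmax_dGmax_ge0 w_gt0 Ggreen G_gt0.
by rewrite mulrC ler_pdivlMr// mulrC; exact: (green_op_ge w_gt0 Ggreen).
Qed.

Lemma green_op_ge_sigma_C1norm t : sigma w G * C1norm w u <= u t.
Proof.
apply: le_trans (green_op_ge w_gt0 Ggreen h t ch h_gt0).
have C1 : C1norm w u <= (Gmax w G + dGmax w G) * I.
  rewrite mulrDl lerD//; apply: (supnorm_le w_gt0) => s; first exact: green_op_norm_int.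
  exact: (green_op_derive1_le w_gt0 Ggreen).
rewrite /sigma mulrAC ler_pdivrMr ?GdG_gt0// -mulrA ler_wpM2l ?(ltW Gmin0)//.
by rewrite mulrC.
Qed.

Lemma green_op_le_C1norm t : u t <= C1norm w u.
Proof.
rewrite (periodic_rem _ (green_op_periodic w_gt0 h)).
have /andP[r0 rw] := rem_period_bounds w_gt0 t.
apply: le_trans (ler_norm _) _.
apply: (@le_trans _ _ (supnorm w u)).
  by apply: (supnorm_ge _ _ _ green_op_norm_int); rewrite r0 ltW.
rewrite lerDl; apply: (supnorm_ge0 w_gt0 _ (dGmax w G * I)) => s.
exact: (green_op_derive1_le w_gt0 Ggreen).
Qed.

End Cone.

(** * The singular nonlinearity *)

(** For sources at most [M], B M + l will bound the truncated solution. The linear part has slope D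
    B < 1, and the gap 1 - D B is shared equally between the sublinear term and the constants. *)
Lemma sublinear_invariant_bound {R : realType} (K0 K1 th D B l : R) :
  0 <= K0 -> 0 <= K1 -> 0 < th < 1 -> 0 <= D -> 0 <= B -> 0 <= l -> D * B < 1 ->
  exists2 M, 0 < M & K0 + K1 * (B * M + l) `^ th + D * (B * M + l) <= M.
Proof.
move=> K00 K10 th01 D0 B0 l0 DB.
have KB : 0 <= K1 * B by rewrite mulr_ge0.
have den0 : 0 < 2 * (K1 * B + 1) by lra.
(* Chosen so that the sublinear term uses at most half of the gap; the summand 1 keeps the
   denominator positive when K1 B = 0. *)
pose eps := (1 - D * B) / (2 * (K1 * B + 1)).
have eps0 : 0 < eps by rewrite divr_gt0// subr_gt0.
have epsE : K1 * B * eps <= (1 - D * B) / 2.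
  have : eps * (2 * (K1 * B + 1)) = 1 - D * B by rewrite /eps divfK// gt_eqF.
  lra.
have [C C0 CP] := powR_sublinear th th01 eps eps0.
pose A := K0 + K1 * C + (K1 * eps + D) * l + 1.
have A0 : 0 < A by rewrite /A ltr_wpDl// !addr_ge0// mulr_ge0// addr_ge0// mulr_ge0// ltW.
(* The other half of the gap, times [M], is exactly [A]. *)
pose M := 2 * A / (1 - D * B).
have M0 : 0 < M by rewrite divr_gt0 ?subr_gt0// mulr_gt0.
have ME : M * (1 - D * B) = 2 * A by rewrite /M divfK// gt_eqF// subr_gt0.
exists M => //.
have Z0 : 0 <= B * M + l by rewrite addr_ge0// mulr_ge0// ltW.
have H1 := ler_wpM2l K10 (CP _ Z0).
have H2 := ler_wpM2r (ltW M0) epsE.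
have AE : A = K0 + K1 * C + (K1 * eps + D) * l + 1 by [].
clearbody A M eps; nra.
Qed.

Definition singular_rhs {R : realType} (b c e : R -> R) (alpha n t z v : R) : R :=
  c t / alpha * z `^ n + e t / alpha * z `^ (1 - alpha)
  + (1 - alpha) * (`|v| ^+ 2 / z) + b t / alpha.

Section Nonlinearity.
Context {R : realType} {w : R} {b c e : R -> R} {alpha n l delta : R}.
Hypothesis w_gt0 : 0 < w.
Hypotheses (cb : continuous b) (cc : continuous c) (ce : continuous e).
Hypotheses (pb : periodic b w) (pc : periodic c w) (pe : periodic e w).
Hypotheses (c_gt0 : forall t, 0 < c t) (e_gt0 : forall t, 0 < e t).
Hypotheses (alpha01 : 0 < alpha < 1) (n_le0 : n <= 0) (l_gt0 : 0 < l).
Hypothesis delta_ge0 : 0 <= delta.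
Hypothesis l_ge : lower w b <= 0 ->
  (- lower w b / lower w e) `^ (1 / (1 - alpha)) <= l.

Notation rhs := (singular_rhs b c e alpha n).

Let alpha_gt0 : 0 < alpha. Proof. by case/andP: alpha01. Qed.
Let alphaC_gt0 : 0 < 1 - alpha. Proof. by case/andP: alpha01; rewrite subr_gt0. Qed.

Lemma lower_c_gt0 : 0 < lower w c.
Proof. by have [[t0 ->] _] := lower_attained c w_gt0 cc pc. Qed.

(** Here the lower bound on [r] enters: passed on to [l], it gives e_* z^(1 - alpha) >= - b_* for z
    >= l. A positive b_* needs no such bound. *)
Lemma source_terms_ge0 t z : l <= z -> 0 <= e t * z `^ (1 - alpha) + b t.
Proof.
move=> lz; have z0 : 0 < z := lt_le_trans l_gt0 lz.
have [_ bt] := lower_attained b w_gt0 cb pb.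
have [[t0 et0] et] := lower_attained e w_gt0 ce pe.
have [b0|b0] := leP (lower w b) 0; last first.
  rewrite addr_ge0 ?mulr_ge0 ?powR_ge0 ?(ltW (e_gt0 t))//.
  exact: le_trans (ltW b0) (bt t).
have e0 : 0 < lower w e by rewrite et0.
have X0 : 0 <= - lower w b / lower w e by apply: divr_ge0; [rewrite oppr_ge0|exact: ltW].
have : - lower w b / lower w e <= z `^ (1 - alpha).
  have -> : - lower w b / lower w e =
      ((- lower w b / lower w e) `^ (1 / (1 - alpha))) `^ (1 - alpha).
    by rewrite -powRrM mul1r mulVf ?powRr1 // gt_eqF.
  apply: ge0_ler_powR.
  - exact: ltW.
  - by rewrite nnegrE powR_ge0.
  - by rewrite nnegrE ltW.
  - exact: le_trans (l_ge b0) lz.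
rewrite ler_pdivrMr // => H.
have := ler_wpM2r (powR_ge0 z (1 - alpha)) (et t).
have := bt t; rewrite mulrC in H; lra.
Qed.

(** All other terms add up to something nonnegative. As n <= 0, an upper bound on [z] thus turns
    into a positive lower bound on the source, which yields both [m] and the a priori bound ||y|| >=
    r. *)
Lemma singular_rhs_ge t z v : l <= z -> lower w c / alpha * z `^ n <= rhs t z v.
Proof.
move=> lz; have z0 : 0 < z := lt_le_trans l_gt0 lz.
have -> : rhs t z v = c t / alpha * z `^ n + ((1 - alpha) * (`|v| ^+ 2 / z)
    + (e t * z `^ (1 - alpha) + b t) / alpha).
  by rewrite /singular_rhs; field; rewrite !gt_eqF.
apply: (@le_trans _ _ (c t / alpha * z `^ n)).
  rewrite ler_wpM2r ?powR_ge0// ler_wpM2r ?invr_ge0 ?(ltW alpha_gt0)//.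
  by have [_] := lower_attained c w_gt0 cc pc.
rewrite lerDl; apply: addr_ge0; last first.
  by apply: divr_ge0; [exact: source_terms_ge0|exact: ltW].
by apply: mulr_ge0; [exact: ltW|apply: divr_ge0; [exact: exprn_ge0|exact: ltW]].
Qed.

(** The power with exponent n <= 0 is largest at [l], and |v| <= delta z turns the singular quotient
    into a term of linear growth. *)
Lemma singular_rhs_le : exists K0 K1 : R, [/\ 0 <= K0, 0 <= K1 &
  forall t z v Z, l <= z -> z <= Z -> `|v| <= delta * z ->
  rhs t z v <= K0 + K1 * Z `^ (1 - alpha) + (1 - alpha) * delta ^+ 2 * Z].
Proof.
have [B B0 Bb] := periodic_bounded b w_gt0 cb pb.
have [C C0 Cc] := periodic_bounded c w_gt0 cc pc.
have [E E0 Ee] := periodic_bounded e w_gt0 ce pe.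
have a0 := ltW alpha_gt0.
exists (C / alpha * l `^ n + B / alpha), (E / alpha); split.
- by rewrite addr_ge0 ?mulr_ge0 ?powR_ge0 ?invr_ge0.
- by rewrite mulr_ge0 ?invr_ge0.
move=> t z v Z lz zZ vz; have z0 : 0 < z := lt_le_trans l_gt0 lz.
have H1 : c t / alpha * z `^ n <= C / alpha * l `^ n.
  apply: ler_pM; rewrite ?powR_ge0 ?mulr_ge0 ?invr_ge0 ?(ltW (c_gt0 t))//.
    by rewrite ler_wpM2r ?invr_ge0// (le_trans (ler_norm _)).
  exact: ler_powRN.
have H2 : e t / alpha * z `^ (1 - alpha) <= E / alpha * Z `^ (1 - alpha).
  apply: ler_pM; rewrite ?powR_ge0 ?mulr_ge0 ?invr_ge0 ?(ltW (e_gt0 t))//.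
    by rewrite ler_wpM2r ?invr_ge0// (le_trans (ler_norm _)).
  apply: ge0_ler_powR; rewrite ?nnegrE ?(ltW alphaC_gt0) ?(ltW z0)//.
  exact: le_trans (ltW z0) zZ.
have H3 : (1 - alpha) * (`|v| ^+ 2 / z) <= (1 - alpha) * delta ^+ 2 * Z.
  rewrite -mulrA ler_wpM2l ?(ltW alphaC_gt0)// ler_pdivrMr//.
  apply: (@le_trans _ _ ((delta * z) ^+ 2)).
    by rewrite lerXn2r ?nnegrE ?mulr_ge0 // ltW.
  rewrite exprMn [z ^+ 2]expr2 -[X in _ <= X]mulrA; apply: ler_wpM2l; first exact: sqr_ge0.
  by apply: ler_wpM2r => //; exact: ltW.
have H4 : b t / alpha <= B / alpha.
  by rewrite ler_wpM2r ?invr_ge0// (le_trans (ler_norm _)).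
rewrite /singular_rhs; lra.
Qed.

Lemma singular_rhs_max_continuous :
  continuous (fun z : R * R * R => rhs z.1.1 (Num.max z.1.2 l) z.2).
Proof.
move=> z; have m0 : 0 < Num.max z.1.2 l by rewrite lt_max l_gt0 orbT.
have c1 : {for z, continuous (fun z : R * R * R => z.1.1)}.
  exact: (continuous_comp cvg_fst cvg_fst).
have c2 : {for z, continuous (fun z : R * R * R => z.1.2)}.
  exact: (continuous_comp cvg_fst cvg_snd).
have cm : {for z, continuous (fun z : R * R * R => Num.max z.1.2 l)}.
  by apply: (continuous_max (g := fun=> l)) => //; exact: cvg_cst.
have cf (f : R -> R) : continuous f ->
    {for z, continuous (fun z : R * R * R => f z.1.1 / alpha)}.
  move=> cf; apply: cvgM; last exact: cvg_cst.
  exact: (continuous_comp c1 (cf _)).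
apply: cvgD; last exact: cf.
apply: cvgD; first apply: cvgD.
- apply: cvgM; first exact: cf.
  exact: (powR_cvg (fun z : R * R * R => Num.max z.1.2 l)).
- apply: cvgM; first exact: cf.
  exact: (powR_cvg (fun z : R * R * R => Num.max z.1.2 l)).
- apply: cvgM; first exact: cvg_cst.
  apply: cvgM; last by apply: cvgV => //; rewrite gt_eqF.
  by rewrite expr2; apply: cvgM; apply: cvg_norm; exact: cvg_snd.
Qed.

End Nonlinearity.

(** * Choice of the constants, removal of the truncation, and the return to x *)

Theorem theorem3p2 (R : realType) (w : R) (p q b c e : R -> R)
    (rho1 rho2 : R) (G : R -> R -> R) (r : R) :
  let alpha : R := 1 / (rho1 + 1) in
  0 < w ->
  continuous p -> continuous q -> continuous b -> continuous c -> continuous e ->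
  periodic p w -> periodic q w -> periodic b w -> periodic c w -> periodic e w ->
  (forall t, 0 < c t) -> (forall t, 0 < e t) ->
  0 < rho1 -> 0 < rho2 -> rho1 < rho2 ->
  is_green w p (fun t => q t / alpha) G ->
  (forall t s, 0 <= t <= w -> 0 <= s <= w -> 0 < G t s) ->
  (1 - alpha) * (Gmax w G + delta w G * Gmin w G) * delta w G ^+ 2 * w
    / sigma w G < 1 ->
  0 < r ->
  (* for lower w b > 0 the base below is negative and its real power undefined;
     no lower bound on r is then imposed *)
  (lower w b <= 0 ->
    1 / sigma w G * (- lower w b / lower w e) `^ (1 / (1 - alpha)) <= r) ->
  r <= (Gmin w G * lower w c * w / alpha) `^ (1 / (alpha + alpha * rho2)) ->
  exists2 Rbound : R, r < Rbound &
  exists y : R -> R,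
    [/\ forall t, 0 < y t,
        periodic_solution w p (fun t => q t / alpha)
          (fun t => c t / alpha * y t `^ (1 - alpha - alpha * rho2)
                    + e t / alpha * y t `^ (1 - alpha)
                    + (1 - alpha) * (`|derive1 y t| ^+ 2 / y t)
                    + b t / alpha) y,
        r <= C1norm w y <= Rbound
      & let x := fun t => y t `^ alpha in
        (forall t, 0 < x t) /\
        periodic_solution w p q
          (fun t => b t / x t `^ rho1 + c t / x t `^ rho2 + e t) x].
Proof.
move=> alpha w0 cp cq cb cc ce pp pq pb pc pe c0 e0 rho10 rho20 rho12.
move=> Ggreen G0 small r0 r_ge r_le.
have rho1S : 0 < rho1 + 1 by lra.
have alpha0 : 0 < alpha by rewrite divr_gt0.
have alphaE : alpha * (rho1 + 1) = 1 by rewrite /alpha mul1r mulVf ?gt_eqF.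
have alpha1 : alpha < 1 by rewrite /alpha ltr_pdivrMr// mul1r ltrDr.
have alpha01 : 0 < alpha < 1 by rewrite alpha0.
clearbody alpha.
have alphaC0 : 0 < 1 - alpha by rewrite subr_gt0.
set n := 1 - alpha - alpha * rho2.
(* Since alpha (rho1 + 1) = 1, the exponent is alpha (rho1 - rho2). *)
have n_lt0 : n < 0.
  have : alpha * rho1 < alpha * rho2 by rewrite ltr_pM2l.
  by rewrite /n; move: alphaE; rewrite mulrDr mulr1; lra.
pose k := fun t => q t / alpha.
have ck : continuous k.
  by move=> t; apply: cvgM; [exact: cq|exact: cvg_cst].
have pk : periodic k w by move=> t; rewrite /k pq.
have s0 := sigma_gt0 w0 Ggreen G0.
have s1 := sigma_le1 w0 Ggreen G0.
have d0 := delta_ge0 w0 Ggreen G0.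
have [Gm0 dG0] := Gmax_dGmax_ge0 w0 Ggreen G0.
have Gmin0 := Gmin_gt0 w0 Ggreen G0.
have lc0 : 0 < lower w c by exact: lower_c_gt0.
have lca0 : 0 <= lower w c / alpha by rewrite divr_ge0// ltW.
pose l := sigma w G * r.
have l0 : 0 < l by rewrite mulr_gt0.
have lr : l <= r by rewrite ler_piMl// ltW.
have l_ge : lower w b <= 0 ->
    (- lower w b / lower w e) `^ (1 / (1 - alpha)) <= l.
  by move=> /r_ge; rewrite div1r ler_pdivrMl.
have [K0 [K1 [K00 K10 rhsle]]] :=
  singular_rhs_le w0 cb cc ce pb pc pe c0 e0 alpha01 (ltW n_lt0) l0 d0.
have Bw0 : 0 <= Gmax w G * w by rewrite mulr_ge0// ltW.
have D0 : 0 <= (1 - alpha) * delta w G ^+ 2 by rewrite mulr_ge0 ?sqr_ge0// ltW.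
(* The condition D B < 1 of [sublinear_invariant_bound] follows from the smallness hypothesis
   because sigma <= 1 and the [delta * Gmin] summand is nonnegative. *)
have kappa1 : (1 - alpha) * delta w G ^+ 2 * (Gmax w G * w) < 1.
  apply: le_lt_trans small; rewrite ler_pdivlMr//.
  apply: (@le_trans _ _ ((1 - alpha) * delta w G ^+ 2 * (Gmax w G * w))).
    by rewrite ler_piMr// mulr_ge0.
  have -> : (1 - alpha) * (Gmax w G + delta w G * Gmin w G) * delta w G ^+ 2 * w =
      (1 - alpha) * delta w G ^+ 2 * (Gmax w G * w) +
      (1 - alpha) * delta w G ^+ 2 * (delta w G * Gmin w G * w) by ring.
  by rewrite lerDl mulr_ge0// mulr_ge0 ?(ltW w0)// mulr_ge0 ?(ltW Gmin0).
have [|M M0 MP] := sublinear_invariant_bound _ _ (1 - alpha) _ _ l K00 K10 _ D0 Bw0 (ltW l0) kappa1.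
  by rewrite alphaC0 ltrBlDl ltrDr.
set Z := Gmax w G * w * M + l in MP.
have lZ : l <= Z by rewrite lerDr mulr_ge0// ltW.
(* [Z] bounds the truncated solution for sources at most [M], so [singular_rhs_ge] yields the second
   argument as a lower bound; the minimum with [M] secures m <= M. *)
pose m := Num.min M (lower w c / alpha * Z `^ n).
have m0 : 0 < m by rewrite lt_min M0 mulr_gt0 ?divr_gt0 ?powR_gt0// (lt_le_trans l0).
have mM : m <= M by rewrite ge_min lexx.
pose g t y v := singular_rhs b c e alpha n t (Num.max y l) v.
have cg : continuous (fun z : R * R * R => g z.1.1 z.1.2 z.2).
  exact: singular_rhs_max_continuous.
have pg t y v : g (t + w) y v = g t y v by rewrite /g /singular_rhs pb pc pe.
have h_gt0 h : source (w := w) (m := m) (M := M) h -> forall s, 0 < h s.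
  exact: source_gt0.
have bounds h : source (w := w) (m := m) (M := M) h ->
    forall t, m <= nemytskii (w := w) (G := G) (g := g) h t <= M.
  move=> hs t; have [ch ph hM] := hs; have hp := h_gt0 h hs.
  rewrite /nemytskii /g; set u := green_op h t; set z := Num.max u l.
  have lz : l <= z by rewrite le_max lexx orbT.
  have uz : u <= z by rewrite le_max lexx.
  have zZ : z <= Z.
    rewrite ge_max lZ andbT.
    apply: le_trans (green_op_le w0 Ggreen h t ch hp) _.
    apply: (@le_trans _ _ (Gmax w G * w * M)); last by rewrite lerDl ltW.
    rewrite -mulrA ler_wpM2l// mulrC; apply: (source_int_le w0) => // s.
    by have /andP[] := hM s.
  have vz : `|derive1 (green_op (w := w) (G := G) h) t| <= delta w G * z.
    apply: le_trans (green_op_derive1_le_delta w0 Ggreen G0 h ch ph hp t) _.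
    by rewrite ler_wpM2l.
  apply/andP; split.
    apply: le_trans (singular_rhs_ge w0 cb cc ce pb pc pe e0 alpha01 l0 l_ge _ _ _ lz).
    rewrite ge_min; apply/orP; right; apply: ler_wpM2l => //.
    by apply: ler_powRN; [exact: ltW|exact: lt_le_trans l0 lz|].
  by apply: le_trans (rhsle _ _ _ _ lz zZ vz) _.
have [h hs hE] := nemytskii_fixed_point w0 Ggreen G0 cp ck pp pk cg pg m0 mM bounds.
have hp := h_gt0 h hs; have [ch ph _] := hs.
have ysol := green_op_solution w0 Ggreen h ch ph hp.
set y := green_op (w := w) (G := G) h in ysol.
have y0 t : 0 < y t by exact: (green_op_gt0 w0 Ggreen G0).
have rC : r <= C1norm w y.
  rewrite leNgt; apply/negP => Cr.
  have hr t : lower w c / alpha * r `^ n <= h t.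
    rewrite hE /nemytskii /g; set z := Num.max _ l.
    have lz : l <= z by rewrite le_max lexx orbT.
    have zr : z <= r.
      rewrite ge_max lr andbT (le_trans _ (ltW Cr))//.
      exact: (green_op_le_C1norm w0 Ggreen G0).
    apply: le_trans (singular_rhs_ge w0 cb cc ce pb pc pe e0 alpha01 l0 l_ge _ _ _ lz).
    apply: ler_wpM2l => //.
    by apply: ler_powRN; [exact: ltW|exact: lt_le_trans l0 lz|].
  have := source_int_ge w0 h ch _ hr => Ir.
  have y0C : y 0 <= C1norm w y by exact: (green_op_le_C1norm w0 Ggreen G0).
  have y0I := green_op_ge w0 Ggreen h 0 ch hp.
  have rX : r <= Gmin w G * (lower w c / alpha * r `^ n * w).
    set X := Gmin w G * lower w c * w / alpha in r_le.
    set s := alpha + alpha * rho2 in r_le.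
    (* This relation turns the hypothesis r^s <= X into r <= X r^n, which is the lower bound that
       the Green function gives for [y]. *)
    have sn : s + n = 1 by rewrite /s /n; ring.
    have sgt0 : 0 < s by rewrite -(ltrD2r n) sn add0r (lt_trans n_lt0).
    have X0 : 0 <= X by rewrite divr_ge0 ?mulr_ge0// ltW.
    have rsX : r `^ s <= X.
      rewrite -[X in _ <= X](powRr1 X0) -(mulVf (lt0r_neq0 sgt0)) powRrM.
      rewrite -div1r; apply: ge0_ler_powR => //; rewrite ?nnegrE ?powR_ge0// ltW//.
    rewrite -{1}(powRr1 (ltW r0)) -sn powRD; last by rewrite (gt_eqF r0) implybT.
    have -> : Gmin w G * (lower w c / alpha * r `^ n * w) = X * r `^ n.
      by rewrite /X; field; rewrite gt_eqF.
    by rewrite ler_wpM2r// powR_ge0.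
  have GI := ler_wpM2l (ltW Gmin0) Ir.
  have := le_lt_trans (le_trans rX (le_trans GI (le_trans y0I y0C))) Cr.
  by rewrite ltxx.
have yl t : l <= y t.
  apply: le_trans (green_op_ge_sigma_C1norm w0 Ggreen G0 h ch ph hp t).
  by rewrite ler_wpM2l// ltW.
have hy t : h t = singular_rhs b c e alpha n t (y t) (derive1 y t).
  by rewrite hE /nemytskii /g max_l.
(* Any bound above the norm will do; the summand 1 makes it exceed [r] strictly. *)
exists (C1norm w y + 1); first by rewrite (le_lt_trans rC)// ltrDl.
exists y; split; first exact: y0.
- by have [py dy eqn] := ysol; split; [exact: py|exact: dy|move=> t; rewrite eqn hy].
- by rewrite rC lerDl ler01.
move=> x; have x0 t : 0 < x t by rewrite powR_gt0.
split; first exact: x0.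
have [py dy eqn] := ysol; split.
- by move=> t; rewrite /x py.
- exact: power_twice_derivable.
move=> t; rewrite /x linop_power ?gt_eqF// -/k eqn hy /singular_rhs.
have yn0 : (y t == 0) = false by rewrite gt_eqF.
(* The factor y^(alpha - 1) produced by the substitution restores the exponents: alpha - 1 + n = -
   alpha rho2 and, as alpha (rho1 + 1) = 1, alpha - 1 = - alpha rho1. *)
have E1 : y t `^ (alpha - 1) * y t `^ n = ((y t `^ alpha) `^ rho2)^-1.
  rewrite -powRrM -powRN -powRD ?yn0 ?implybT//; congr (_ `^ _).
  by rewrite /n; ring.
have E2 : y t `^ (alpha - 1) * y t `^ (1 - alpha) = 1.
  by rewrite -powRD ?yn0 ?implybT// -opprB addNr powRr0.
have E3 : y t `^ (alpha - 1) = ((y t `^ alpha) `^ rho1)^-1.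
  rewrite -powRrM -powRN; congr (_ `^ _).
  by rewrite -[X in _ - X]alphaE mulrDr mulr1 opprD addrCA subrr addr0.
rewrite -E1 -E3 addrAC addrK.
have et : e t * (y t `^ (alpha - 1) * y t `^ (1 - alpha)) = e t by rewrite E2 mulr1.
rewrite -[X in _ = _ + X]et.
by field; rewrite gt_eqF.
Qed.
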